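(* Assume that $\int_0^{K_2}f_2(s)\,ds>0$. Then for any $\eta>0$ there is $l_2^{**}>0$ such that, if $l_2\ge l_2^{**}$ and if $u$ is the solution of the patch problem (P) with a nonnegative continuous and compactly supported initial datum $u_0\not\equiv0$ satisfying $u_0\ge\theta+\eta$ on an interval of size $l_2^{**}$ included in a patch of type 2, then $u$ is locally persistent, namely, for every bounded interval $H\subset\mathbb{R}$, $$\inf_{x\in H}\Big(\liminf_{t\to+\infty}u(t,x)\Big)>0.$$
   Context: Setting. Let $l_1,l_2,d_1,d_2,\sigma>0$ and $l=l_1+l_2$; here $l_1,d_1,d_2,\sigma,f_1,f_2$ are given and $l_2$ varies. The real line is divided into patches of type 1 (KPP), $(nl-l_1,nl)$, and of type 2 (bistable), $(nl,nl+l_2)$, $n\in\mathbb{Z}$. Set $S_1=l\mathbb{Z}$, $S_2=l\mathbb{Z}+l_2$, $S=S_1\cup S_2$. Let $d(x)=d_1$, $f(x,s)=f_1(s)$ for $x\in(nl-l_1,nl)$ and $d(x)=d_2$, $f(x,s)=f_2(s)$ for $x\in(nl,nl+l_2)$. The functions $f_1,f_2\in C^1(\mathbb{R})$ satisfy, for some $K_1,K_2>0$ and $\theta\in(0,K_2)$: (KPP) $f_1(0)=f_1(K_1)=0$, $0<f_1(s)\le f_1'(0)s$ for $s\in(0,K_1)$, $f_1'(K_1)<0$, $f_1<0$ in $(-\infty,0)\cup(K_1,+\infty)$; (Bistable) $f_2(0)=f_2(\theta)=f_2(K_2)=0$, $f_2'(0)<0$, $f_2'(\theta)>0$, $f_2'(K_2)<0$,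 $f_2<0$ in $(0,\theta)\cup(K_2,+\infty)$, $f_2>0$ in $(-\infty,0)\cup(\theta,K_2)$. The patch problem (P) is $$\begin{cases}u_t-d(x)u_{xx}=f(x,u), & t>0,\ x\in\mathbb{R}\setminus S,\\ u(t,x^-)=u(t,x^+),\quad u_x(t,x^-)=\sigma u_x(t,x^+), & t>0,\ x\in S_1,\\ u(t,x^-)=u(t,x^+),\quad \sigma u_x(t,x^-)=u_x(t,x^+), & t>0,\ x\in S_2.\end{cases}$$ A solution with bounded, nonnegative, continuous initial datum $u_0$ is the (unique) continuous function $u$ on $[0,+\infty)\times\mathbb{R}$, bounded on $[0,T]\times\mathbb{R}$ for all $T>0$, with $u(0,\cdot)=u_0$, which is $C^1$ in $t$ and $C^2$ in $x$ on $(0,+\infty)\times\overline{I}$ for each patch $I$, and satisfies (P) classically. *)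

(* Defs.v *)
From HB Require Import structures.
From mathcomp Require Import all_boot all_order all_algebra.
From mathcomp Require Import all_classical all_reals all_analysis.
Set Implicit Arguments.
Unset Strict Implicit.
Unset Printing Implicit Defensive.
Import Order.TTheory GRing.Theory Num.Theory.
Import numFieldNormedType.Exports.
Local Open Scope classical_set_scope.
Local Open Scope ring_scope.

Definition C1 (R : realType) (f : R -> R) : Prop :=
  (forall s : R, derivable f s 1) /\ continuous (derive1 f).

Definition kpp (R : realType) (f : R -> R) (K : R) : Prop :=
  [/\ 0 < K, f 0 = 0 /\ f K = 0,
      forall s : R, 0 < s < K -> 0 < f s /\ f s <= derive1 f 0 * s,
      derive1 f K < 0
    & forall s : R, s < 0 \/ K < s -> f s < 0].

Definition bistable (R : realType) (f : R -> R) (theta K : R) : Prop :=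
  [/\ 0 < theta < K,
      [/\ f 0 = 0, f theta = 0 & f K = 0],
      [/\ derive1 f 0 < 0, 0 < derive1 f theta & derive1 f K < 0],
      forall s : R, 0 < s < theta \/ K < s -> f s < 0
    & forall s : R, s < 0 \/ theta < s < K -> 0 < f s].

Definition patch1 (R : realType) (l1 l2 : R) (n : int) : set R :=
  `]n%:~R * (l1 + l2) - l1, n%:~R * (l1 + l2)[%classic.

Definition patch2 (R : realType) (l1 l2 : R) (n : int) : set R :=
  `]n%:~R * (l1 + l2), n%:~R * (l1 + l2) + l2[%classic.

Definition S1 (R : realType) (l1 l2 : R) : set R :=
  [set x | exists n : int, x = n%:~R * (l1 + l2)].

Definition S2 (R : realType) (l1 l2 : R) : set R :=
  [set x | exists n : int, x = n%:~R * (l1 + l2) + l2].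

(* The values at the interfaces, which the problem never uses, are those of
   type 2. *)
Definition diffusivity (R : realType) (l1 l2 d1 d2 : R) (x : R) : R :=
  if x \in \bigcup_n patch1 l1 l2 n then d1 else d2.

Definition reaction (R : realType) (l1 l2 : R) (f1 f2 : R -> R) (x s : R) : R :=
  if x \in \bigcup_n patch1 l1 l2 n then f1 s else f2 s.

(* Regularity C^{1;2}_{t;x} of u on (0,+oo) x [a,b], up to x = a and x = b: the
   derivatives u_t, u_x, u_xx of u in the open patch extend to continuous
   functions of (t,x) on (0,+oo) x [a,b]. Since u(t,.) need not be derivable at the
   interfaces, the (two-sided) x-derivatives are only taken at interior
   points. *)
Definition C12 (R : realType) (u : R -> R -> R) (a b : R) : Prop :=
  let Q := [set z : R * R | 0 < z.1 /\ a <= z.2 <= b] in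
  exists ut ux uxx : R -> R -> R,
    [/\ {within Q, continuous (fun z : R * R => ut z.1 z.2)},
        {within Q, continuous (fun z : R * R => ux z.1 z.2)},
        {within Q, continuous (fun z : R * R => uxx z.1 z.2)},
        forall t x : R, 0 < t -> a <= x <= b ->
          is_derive t 1 (fun s => u s x) (ut t x)
      & forall t x : R, 0 < t -> a < x < b ->
          is_derive x 1 (u t) (ux t x) /\ is_derive x 1 (ux t) (uxx t x)].

(* v(x^-) = v(x^+) and p * v'(x^-) = q * v'(x^+), all one-sided limits existing. *)
Definition interface (R : realType) (p q : R) (v : R -> R) (x : R) : Prop :=
  (exists c : R, (v y @[y --> x^'-] --> c) /\ (v y @[y --> x^'+] --> c)) /\
  (exists c c' : R, [/\ derive1 v y @[y --> x^'-] --> c,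
                        derive1 v y @[y --> x^'+] --> c' & p * c = q * c']).

(* Only the values u t x with 0 <= t are meaningful. *)
Record patch_solution (R : realType) (l1 l2 d1 d2 sigma : R) (f1 f2 : R -> R)
    (u0 : R -> R) (u : R -> R -> R) : Prop := {
  sol_continuous :
    {within [set z : R * R | 0 <= z.1], continuous (fun z : R * R => u z.1 z.2)};
  sol_bounded : forall T : R, 0 < T ->
    exists M : R, forall t x : R, 0 <= t <= T -> `|u t x| <= M;
  sol_init : forall x : R, u 0 x = u0 x;
  sol_C12_patch1 : forall n : int,
    C12 u (n%:~R * (l1 + l2) - l1) (n%:~R * (l1 + l2));
  sol_C12_patch2 : forall n : int,
    C12 u (n%:~R * (l1 + l2)) (n%:~R * (l1 + l2) + l2);
  sol_pde : forall t x : R, 0 < t ->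
    ~ (S1 l1 l2 `|` S2 l1 l2) x ->
    derive1 (fun s => u s x) t - diffusivity l1 l2 d1 d2 x * derive1 (derive1 (u t)) x
      = reaction l1 l2 f1 f2 x (u t x);
  sol_S1 : forall t x : R, 0 < t -> S1 l1 l2 x -> interface 1 sigma (u t) x;
  sol_S2 : forall t x : R, 0 < t -> S2 l1 l2 x -> interface sigma 1 (u t) x
}.

Definition locally_persistent (R : realType) (u : R -> R -> R) : Prop :=
  forall H : set R, is_interval H -> bounded_set H ->
    (0 < ereal_inf [set limf_einf (fun t : R => (u t x)%:E) +oo%R | x in H])%E.

(* Main.v *)
Require Import Defs.
From mathcomp Require Import all_boot all_order all_algebra.
From mathcomp Require Import all_classical all_reals all_analysis.
From mathcomp Require Import ring lra.
Import Order.TTheory GRing.Theory Num.Theory.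
Import numFieldNormedType.Exports.
Local Open Scope classical_set_scope.
Local Open Scope ring_scope.

Set Implicit Arguments.
Unset Strict Implicit.
Unset Printing Implicit Defensive.

(** The whole proof is a chain of comparisons with explicit subsolutions that are
    strict: the differential inequality is strict inside the patches, and the flux
    of the subsolution, i.e. [v'] in the patches of type 1 and [sigma * v'] in those
    of type 2, jumps strictly upwards at the interfaces. For such a subsolution
    [phi] the comparison principle ([comparison]) is elementary: at the first time
    and at a point where [phi] touches the solution [u], the difference [u - phi]
    has a minimum, and either the equation or the transmission condition for [u]
    is violated. At that point the reaction terms of [u] and [phi] are equal.

    Four subsolutions are used.

    - Since [f1 s] and [f2 s] are at least a multiple of [s] for [s < 0] bounded,
      small multiples of a growing profile with downward kinks, multiplied by
      [- exp (A t)], lie below [u]; hence [u >= 0] ([solution_ge0]). Afterwards a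
      subsolution may be negative wherever this is convenient, in particular at
      the boundary of the domain of comparison.

    - In a patch of type 2, on a long interval where [u0 >= theta + eta], a flat
      concave parabola moves up from a level above [theta] to a level close to
      [K2] in a finite time ([bistable_rise]); this fixes the length [L].

    - Because [f2] has a positive integral over [[0, K2]], the equation
      [d2 psi'' + f2 psi = d2 e] has, for some small [e > 0], a solution which is
      positive at its centre, negative at the ends of a bounded interval and stays
      below a level [m < K2] ([subsolution_bump]); it is built by quadrature from
      the energy identity. Once [u] has risen above [m] on this interval, it stays
      above [psi] for ever ([bump_persists]), so [u] is bounded from below at the
      centre of the bump.

    - A positive lower bound at one point, valid for all large times, spreads to any
      bounded interval ([positivity_spreads]): near [0] the reactions are at least
      [- M s], which is dominated by the diffusion of a steep exponential with
      upward kinks, and a constant decreasing in time is subtracted from it so that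
      it starts from negative values.

    The profiles that cross interfaces are exponentials of a phase with prescribed
    fluxes ([phase], [profile]): in the variable [y] with [y' = 1 / p], where [p] is
    the flux weight, the flux is the [y]-derivative, so a linear function of [y]
    has no kink, and a quadratic correction in each patch produces kinks of
    either sign. *)

(** * One-variable calculus *)

(** Pointwise forms of the derivation rules, so that the derivative of an
    explicit expression can be given as a term. *)

Lemma is_derive_cstf (R : realType) (x k : R) :
  is_derive x (1 : R) (fun _ : R => k) 0.
Proof. exact: is_derive_cst. Qed.

Lemma is_derive_addf (R : realType) (f g : R -> R) (x a b : R) :
  is_derive x 1 f a -> is_derive x 1 g b ->
  is_derive x 1 (fun y => f y + g y) (a + b).
Proof. by move=> fa gb; exact: is_deriveD. Qed.

Lemma is_derive_subf (R : realType) (f g : R -> R) (x a b : R) :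
  is_derive x 1 f a -> is_derive x 1 g b ->
  is_derive x 1 (fun y => f y - g y) (a - b).
Proof. by move=> fa gb; exact: is_deriveB. Qed.

Lemma is_derive_mulf (R : realType) (f g : R -> R) (x a b : R) :
  is_derive x 1 f a -> is_derive x 1 g b ->
  is_derive x 1 (fun y => f y * g y) (a * g x + f x * b).
Proof.
move=> fa gb; apply: (is_derive_eq (is_deriveM fa gb)).
by rewrite /GRing.scale /= addrC mulrC.
Qed.

Lemma is_derive_Mlf (R : realType) (f : R -> R) (x k a : R) :
  is_derive x 1 f a -> is_derive x 1 (fun y => k * f y) (k * a).
Proof.
move=> fa; apply: (is_derive_eq (is_derive_mulf (is_derive_cstf x k) fa)).
by rewrite mul0r add0r.
Qed.

Lemma is_derive_sqrf (R : realType) (f : R -> R) (x a : R) :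
  is_derive x 1 f a -> is_derive x 1 (fun y => f y ^+ 2) (2 * f x * a).
Proof.
by move=> fa; apply: (is_derive_eq (is_derive_mulf fa fa)); ring.
Qed.

Lemma is_derive_idf (R : realType) (x : R) :
  is_derive x (1 : R) (fun y : R => y) 1.
Proof. exact: is_derive_id. Qed.

Lemma is_derive_invf (R : realType) (f : R -> R) (x a : R) :
  is_derive x 1 f a -> f x != 0 ->
  is_derive x 1 (fun y => (f y)^-1) (- (f x) ^- 2 * a).
Proof. by move=> fa fx; exact: is_deriveV. Qed.

Lemma is_derive_expf (R : realType) (f : R -> R) (x a : R) :
  is_derive x 1 f a ->
  is_derive x 1 (fun y => expR (f y)) (expR (f x) * a).
Proof. by move=> fa; exact: is_derive1_comp. Qed.

Lemma is_derive_continuous (R : realType) (f : R -> R) (x a : R) :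
  is_derive x 1 f a -> {for x, continuous f}.
Proof.
case=> fx _; apply/differentiable_continuous.
by rewrite -derivable1_diffP.
Qed.

Lemma C1_is_derive (R : realType) (f : R -> R) (x : R) :
  C1 f -> is_derive x 1 f (derive1 f x).
Proof. by move=> [df _]; rewrite derive1E; exact/derivableP. Qed.

(** If the slope [w'] vanished with [w'' < 0], then [w'] would be negative just
    to the right of [x], and [w] would go below its minimum. *)
Lemma min_second_derivative_ge0 (R : realType) (w w' : R -> R) (x w'' : R) :
  (\forall y \near x, is_derive (y : R) 1 w (w' y)) -> is_derive x 1 w' w'' ->
  (\forall y \near x, w x <= w y) -> 0 <= w''.
Proof.
move=> wd w'd wmin.
have /nbhs_ballP[e /= e0 ball_e] : \forall y \near x,
    is_derive (y : R) 1 w (w' y) /\ w x <= w y by near=> y; split; near: y.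
have in_ball y : x - e < y < x + e -> is_derive (y : R) 1 w (w' y) /\ w x <= w y.
  by move=> xy; apply: ball_e; rewrite /ball /= ltr_distlC.
have w'0 : w' x = 0.
  have [||||_ <-] := @derive1_at_min R w (x - e) (x + e) x.
  - lra.
  - by move=> t; rewrite in_itv /= => /in_ball[[]].
  - by rewrite in_itv /=; lra.
  - by move=> t; rewrite in_itv /= => /in_ball[].
  - by have [|[_ <-]] := in_ball x; first lra.
rewrite leNgt; apply/negP => w''0.
(* The difference quotients of w' at x tend to w'' < 0. *)
have slope : \forall h \near 0^', h^-1 * w' (h + x) < 0.
  have [dw' w'E] := w'd.
  have : h^-1 *: (w' (h *: (1 : R) + x) - w' x) @[h --> 0^'] --> w''.
    by rewrite -w'E; exact: dw'.
  move/(@cvgr_lt _ _ _ _ _)/(_ _ w''0); apply: filterS => h /=.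
  by rewrite w'0 subr0 /GRing.scale /= mulr1.
have /nbhs_ballP[r /= r0 ball_r] := slope.
pose s := Order.min e r / 2.
have s0 : 0 < s by rewrite divr_gt0// lt_min e0.
have se : s < e.
  have : Order.min e r <= e by rewrite ge_min lexx.
  by rewrite /s; move: e0; lra.
have sr : s < r.
  have : Order.min e r <= r by rewrite ge_min lexx orbT.
  by rewrite /s; move: r0; lra.
have [|||c] := @MVT R w w' x (x + s).
- lra.
- by move=> y; rewrite in_itv /= => xy; have [|] := in_ball y; first lra.
- apply: derivable_within_continuous => y; rewrite in_itv /= => xy.
  by have [|[]] := in_ball y; first lra.
rewrite in_itv /= => xc; have -> : x + s - x = s by ring.
have [|_] := in_ball (x + s); first lra.
have : (c - x)^-1 * w' (c - x + x) < 0.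
  apply: ball_r; last by rewrite /=; apply/eqP; lra.
  by rewrite /ball /= sub0r normrN gtr0_norm; lra.
rewrite subrK pmulr_rlt0 ?invr_gt0; last lra.
by move=> w'c wle wE; have : w' c * s < 0; [rewrite pmulr_llt0|lra].
Unshelve. all: by end_near. Qed.

(** A positive limit slope would make [w] increase up to its minimum [w x]. *)
Lemma min_left_slope_le0 (R : realType) (w w' : R -> R) (x c : R) :
  {for x, continuous w} ->
  (\forall y \near x^'-, is_derive (y : R) 1 w (w' y)) ->
  w' y @[y --> x^'-] --> c ->
  (\forall y \near x^'-, w x <= w y) -> c <= 0.
Proof.
move=> wc wd w'c wmin; rewrite leNgt; apply/negP => c0.
have : \forall y \near x^'-,
    [/\ is_derive (y : R) 1 w (w' y), 0 < w' y & w x <= w y].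
  by near=> y; split; near: y => //; exact: (cvgr_gt _ w'c).
move/nbhs_ballP => [e /= e0 ball_e].
have in_ball y : x - e < y < x ->
    [/\ is_derive (y : R) 1 w (w' y), 0 < w' y & w x <= w y].
  by move=> /andP[? ?]; apply: ball_e => //=; rewrite /ball /= ltr_distlC; lra.
have [|||z] := @MVT R w w' (x - e / 2) x; first lra.
- by move=> y; rewrite in_itv /= => xy; have [|] := in_ball y; first lra.
- apply: continuous_in_subspaceT => y; rewrite inE /= in_itv /= => /andP[xy yx].
  have [->//|yneq] := eqVneq y x.
  have yltx : y < x by rewrite lt_neqAle yneq.
  by have [|/is_derive_continuous] := in_ball y; first lra.
rewrite in_itv /= => xz; have -> : x - (x - e / 2) = e / 2 by ring.
have [|_ w'z _] := in_ball z; first lra.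
have [|_ _ wle] := in_ball (x - e / 2); first lra.
by move=> wE; have : 0 < w' z * (e / 2); [apply: mulr_gt0; lra|lra].
Unshelve. all: by end_near. Qed.

Lemma min_right_slope_ge0 (R : realType) (w w' : R -> R) (x c : R) :
  {for x, continuous w} ->
  (\forall y \near x^'+, is_derive (y : R) 1 w (w' y)) ->
  w' y @[y --> x^'+] --> c ->
  (\forall y \near x^'+, w x <= w y) -> 0 <= c.
Proof.
move=> wc wd w'c wmin; rewrite leNgt; apply/negP => c0.
have : \forall y \near x^'+,
    [/\ is_derive (y : R) 1 w (w' y), w' y < 0 & w x <= w y].
  by near=> y; split; near: y => //; exact: (cvgr_lt _ w'c).
move/nbhs_ballP => [e /= e0 ball_e].
have in_ball y : x < y < x + e ->
    [/\ is_derive (y : R) 1 w (w' y), w' y < 0 & w x <= w y].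
  by move=> /andP[? ?]; apply: ball_e => //=; rewrite /ball /= ltr_distlC; lra.
have [|||z] := @MVT R w w' x (x + e / 2); first lra.
- by move=> y; rewrite in_itv /= => xy; have [|] := in_ball y; first lra.
- apply: continuous_in_subspaceT => y; rewrite inE /= in_itv /= => /andP[xy yx].
  have [->//|yneq] := eqVneq y x.
  have yltx : x < y by rewrite lt_neqAle eq_sym yneq.
  by have [|/is_derive_continuous] := in_ball y; first lra.
rewrite in_itv /= => xz; have -> : x + e / 2 - x = e / 2 by ring.
have [|_ w'z _] := in_ball z; first lra.
have [|_ _ wle] := in_ball (x + e / 2); first lra.
by move=> wE; have : 0 < - w' z * (e / 2); [apply: mulr_gt0; lra|lra].
Unshelve. all: by end_near. Qed.

Lemma C1_Lipschitz (R : realType) (f : R -> R) (N : R) : C1 f -> 0 < N ->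
  exists2 M : R, 0 < M & forall x y : R, - N <= x -> x <= y -> y <= N ->
    `|f y - f x| <= M * (y - x).
Proof.
move=> f_C1 N0; have [_ cf'] := f_C1.
have cf'N : {within `[- N, N], continuous (fun x => `|derive1 f x|)}.
  apply: continuous_subspaceT => x; apply: continuous_comp; first exact: cf'.
  exact: norm_continuous.
have [|c _ cmax] := @EVT_max R _ (- N) N _ cf'N; first lra.
exists (`|derive1 f c| + 1); first by rewrite ltr_wpDl.
move=> x y Nx; rewrite le_eqVlt => /predU1P[->|xy] yN.
  by rewrite !subrr normr0 mulr0.
have [||z] := @MVT R f (derive1 f) x y xy.
- by move=> z _; exact: C1_is_derive.
- by apply: derivable_within_continuous => z _; have [] := C1_is_derive z f_C1.
rewrite in_itv /= => xzy ->; rewrite normrM (gtr0_norm (x := y - x)) ?subr_gt0//.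
rewrite ler_wpM2r ?subr_ge0 ?ltW//.
have : z \in `[- N, N] by rewrite in_itv /=; lra.
by move/cmax; lra.
Qed.

(** * A stationary compactly supported subsolution of the bistable equation *)

Lemma primitive_on_segment (R : realType) (f : R -> R) (a b : R) :
  (forall x, a <= x <= b -> {for x, continuous f}) ->
  exists F : R -> R, forall x, a < x < b -> is_derive x 1 F (f x).
Proof.
move=> fc; exists (fun x => \int[lebesgue_measure]_(t in `[a, x]) f t).
move=> x /andP[ax xb].
have fi : lebesgue_measure.-integrable `[a, b] (EFin \o f).
  apply: continuous_compact_integrable; first exact: segment_compact.
  apply: continuous_in_subspaceT => y; rewrite inE /= in_itv /=; exact: fc.
have [|dF F'E] := continuous_FTC1_closed xb fi ax; first by apply: fc; lra.
by apply: DeriveDef; [exact: dF|rewrite -derive1E].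
Qed.

Lemma is_derive_lt (R : realType) (F f : R -> R) (a b : R) : a < b ->
  (forall x, a <= x <= b -> is_derive x 1 F (f x)) ->
  (forall x, a < x < b -> 0 < f x) -> F a < F b.
Proof.
move=> ab Ff f0; have [||c] := @MVT R F f a b ab.
- by move=> x; rewrite in_itv /= => xab; apply: Ff; lra.
- apply: derivable_within_continuous => x; rewrite in_itv /= => xab.
  by have [] := Ff x xab.
rewrite in_itv /= => /f0 fc FE; rewrite -subr_gt0 FE.
by rewrite mulr_gt0 // subr_gt0.
Qed.

(** Separation of variables: [y] is the inverse of a primitive of [1 / k]. *)
Lemma autonomous_ode (R : realType) (k : R -> R) (Z1 Z : R) : 0 < Z1 < Z ->
  (forall z, - Z <= z <= Z -> 0 < k z /\ {for z, continuous k}) ->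
  exists (a b : R) (y : R -> R), [/\ a < 0 < b, y a = - Z1, y b = Z1, y 0 = 0 &
    forall x, a <= x <= b -> - Z1 <= y x <= Z1 /\ is_derive x 1 y (k (y x))].
Proof.
move=> Z1Z kP.
have [|F FP] := @primitive_on_segment R (fun z => (k z)^-1) (- Z) Z.
  by move=> z /kP[k0 kc]; apply: cvgV => //; rewrite gt_eqF.
pose X z := F z - F 0.
have XP z : - Z < z < Z -> is_derive z 1 X (k z)^-1.
  move=> zZ; rewrite -[(k z)^-1]subr0.
  exact: is_derive_subf (FP _ zZ) (is_derive_cstf _ _).
have kV z : - Z < z < Z -> 0 < (k z)^-1.
  by move=> zZ; rewrite invr_gt0; have [|] := kP z; first lra.
have Xlt z z' : - Z < z -> z < z' -> z' < Z -> X z < X z'.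
  move=> zZ zz' z'Z; apply: (@is_derive_lt _ _ (fun z => (k z)^-1)) => // t tP.
    by apply: XP; lra.
  by apply: kV; lra.
have Xinj z z' : - Z < z < Z -> - Z < z' < Z -> X z = X z' -> z = z'.
  move=> zZ z'Z XE; have [zz'|zz'|//] := ltgtP z z'.
    have : X z < X z' by apply: Xlt; lra.
    by rewrite XE ltxx.
  have : X z' < X z by apply: Xlt; lra.
  by rewrite XE ltxx.
pose y x := xget 0 [set z | - Z < z < Z /\ X z = x].
have yK z : - Z < z < Z -> y (X z) = z.
  move=> zZ; rewrite /y; case: xgetP => [t _ [tZ tE]|/(_ z)[]//].
  exact: Xinj.
have X0 : X 0 = 0 by rewrite /X subrr.
exists (X (- Z1)), (X Z1), y; split.
- by rewrite -X0 !Xlt //; lra.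
- by rewrite yK //; lra.
- by rewrite yK //; lra.
- by rewrite -X0 yK //; lra.
move=> x xab.
have [|||z] := @IVT R X (- Z1) Z1 x; first lra.
- apply: derivable_within_continuous => z; rewrite in_itv /= => zZ.
  by have [|] := XP z; first lra.
- have XZ : X (- Z1) < X Z1 by apply: Xlt; lra.
  by rewrite minEle maxEle (ltW XZ).
rewrite in_itv /= => zZ1 <-; rewrite yK; last lra.
split=> //; rewrite -[k z]invrK.
have near_z : \forall t \near z, - Z < t < Z.
  have : z \in `]- Z, Z[ by rewrite in_itv /=; lra.
  by move/near_in_itvoo; apply: filterS => t; rewrite in_itv.
apply: is_derive_inverse.
- by near=> t; apply: yK; near: t.
- near=> t; have /is_derive_continuous : is_derive (t : R) 1 X (k t)^-1.
    by apply: XP; near: t.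
  exact.
- by apply: XP; lra.
- by rewrite gt_eqF // kV //; lra.
Unshelve. all: by end_near. Qed.

(** The peak [m] of the bump is taken just below [K]: since [f] has positive
    integral over [[0, K]], the potential [F] is then larger at [m] than
    anywhere between a negative level and [m]. *)
Lemma potential_peak (R : realType) (f : R -> R) (theta K : R) :
  C1 f -> bistable f theta K ->
  0 < \int[lebesgue_measure]_(s in `[0, K]) f s ->
  exists (F : R -> R) (m : R), [/\ 0 < theta < m, m < K,
    forall s, -1 < s < K + 1 -> is_derive s 1 F (f s) &
    forall s, -1 < s < m -> F s < F m].
Proof.
move=> f_C1 [/andP[th0 thK] [f0 fth fK] _ fneg fpos] mass.
have fc x : {for x, continuous f} := is_derive_continuous (C1_is_derive x f_C1).
have [|F FP] := @primitive_on_segment R f (-1) (K + 1); first by [].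
have F0K : F 0 < F K.
  have := mass; rewrite /Rintegral (@continuous_FTC2 R f F 0 K).
  - by rewrite -EFinB /= subr_gt0.
  - lra.
  - apply: continuous_in_subspaceT => x _; exact: fc.
  - split.
    + by move=> x; rewrite in_itv /= => xK; have [|] := FP x; first lra.
    + by apply: cvg_at_right_filter; apply: is_derive_continuous; apply: FP; lra.
    + by apply: cvg_at_left_filter; apply: is_derive_continuous; apply: FP; lra.
  - move=> x; rewrite in_itv /= => xK; rewrite derive1E.
    by have [|_ ->] := FP x; first lra.
have Fdec s s' : 0 <= s -> s < s' -> s' <= theta -> F s' < F s.
  move=> s0 ss' s'th; rewrite -ltrN2.
  apply: (@is_derive_lt R (fun x => - F x) (fun x => - f x)) => // x xs.
    by apply: is_deriveN; apply: FP; lra.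
  by rewrite oppr_gt0; apply: fneg; left; lra.
have Finc s s' : theta <= s -> s < s' -> s' <= K -> F s < F s'.
  move=> s0 ss' s'th; apply: (@is_derive_lt R F f) => // x xs.
    by apply: FP; lra.
  by apply: fpos; right; lra.
have Finc0 s : -1 < s < 0 -> F s < F 0.
  move=> s0; apply: (@is_derive_lt R F f) => [|x xs|x xs]; first lra.
    by apply: FP; lra.
  by apply: fpos; left; lra.
have [m [mK mth F0m]] : exists m, [/\ m < K, theta < m & F 0 < F m].
  have : \forall m \near K^'-, [/\ m < K, theta < m & F 0 < F m].
    near=> m; split; near: m.
    - exact: nbhs_left_lt.
    - exact: nbhs_left_gt.
    - apply: cvgr_gt F0K; apply: cvg_at_left_filter.
      by apply: is_derive_continuous; apply: FP; lra.
  by move/filter_ex.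
exists F, m; split=> //; first lra.
move=> s /andP[s1 sm].
have [s0|s0] := ltP s 0; first by apply: lt_trans F0m; apply: Finc0; lra.
have [sth|ths] := leP s theta; last by apply: Finc; lra.
have [<-//|s00] := eqVneq 0 s.
have : F s < F 0 by apply: Fdec; rewrite // lt_neqAle s00.
lra.
Unshelve. all: by end_near. Qed.

Lemma continuous_extension_segment (R : realType) (f : R -> R) (a b : R) :
  a < b -> (forall x, a <= x <= b -> {for x, continuous f}) ->
  exists2 g : R -> R, continuous g & forall x, a <= x <= b -> g x = f x.
Proof.
move=> ab fc; pose clamp x := (`|x - a| - `|x - b| + (a + b)) / 2.
have clampE x : a <= x <= b -> clamp x = x.
  by move=> xab; rewrite /clamp ger0_norm ?ler0_norm; lra.
have clamp_ab x : a <= clamp x <= b.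
  by rewrite /clamp; case: (ger0P (x - a)); case: (ger0P (x - b)); lra.
exists (f \o clamp) => [x|x /clampE /= -> //].
apply: continuous_comp; last exact: fc.
apply: cvgM; last exact: cvg_cst.
apply: cvgD; last exact: cvg_cst.
by apply: cvgB; apply: cvg_norm; apply: cvgB; by [exact: cvg_id|exact: cvg_cst].
Qed.

(** The profile is sought in the form [psi = m - y ^ 2] with [y' = k y], so that
    the peak is a regular point of the equation for [y]. With
    [F s - F m = g s * (s - m)], the choice
    [k z ^ 2 = (g (m - z ^ 2) / d - e) / 2] amounts to the energy identity
    [psi'^2 / 2 = (F m - F psi) / d - e * (m - psi)], hence to
    [d * psi'' + f psi = d * e > 0]; it is admissible, i.e. [k > 0], as soon as
    [m] is the peak of the potential [F] and [e] is small. *)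
Lemma subsolution_bump (R : realType) (f : R -> R) (theta K d : R) : 0 < d ->
  C1 f -> bistable f theta K ->
  0 < \int[lebesgue_measure]_(s in `[0, K]) f s ->
  exists (m a b : R) (psi psi' psi'' : R -> R),
    [/\ 0 < m < K, a < 0 < b, psi a < 0 /\ psi b < 0, 0 < psi 0 &
      [/\ continuous psi, forall x, a <= x <= b -> psi x <= m &
      forall x, a < x < b -> [/\ is_derive x 1 psi (psi' x),
        is_derive x 1 psi' (psi'' x) & 0 < d * psi'' x + f (psi x)]]].
Proof.
move=> d0 f_C1 f_bi mass.
have [F [m [thm mK FP Fm]]] := potential_peak f_C1 f_bi mass.
have fm0 : 0 < f m.
  by case: f_bi => _ _ _ _; apply; right; lra.
have /is_derive1_caratheodory[g [gE gc gm]] : is_derive m 1 F (f m).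
  by apply: FP; lra.
have gq s : s != m -> g s = (F s - F m) / (s - m).
  by move=> sm; rewrite gE mulfK // subr_eq0.
have gd s : -1 < s < K + 1 -> s != m -> is_derive s 1 g ((f s - g s) / (s - m)).
  move=> sK sm; have sm0 : s - m != 0 by rewrite subr_eq0.
  apply: (@near_eq_is_derive _ _ _ (fun t => (F t - F m) * (t - m)^-1)).
    near=> t; rewrite gq //; near: t.
    by apply: open_nbhs_nbhs; split=> //; exact: open_neq.
  apply: (is_derive_eq (is_derive_mulf
    (is_derive_subf (FP s sK) (is_derive_cstf s (F m)))
    (is_derive_invf (is_derive_subf (is_derive_idf s) (is_derive_cstf s m)) sm0))).
  by rewrite gE /GRing.scale /=; field.
have gcont s : -1 < s < K + 1 -> {for s, continuous g}.
  move=> sK; have [->//|sm] := eqVneq s m.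
  exact: is_derive_continuous (gd s sK sm).
have gpos s : -1 < s <= m -> 0 < g s.
  move=> sm; have [->|sm'] := eqVneq s m.
    by rewrite gm.
  by rewrite gq // ltr_ndivlMr; have := Fm s; lra.
have [e e0 eg] : exists2 e, 0 < e & forall s, - 2^-1 <= s <= m -> e < g s / d.
  have [||c] := @EVT_min R g (- 2^-1) m; first lra.
    apply: continuous_in_subspaceT => s; rewrite inE /= in_itv /= => sm.
    by apply: gcont; lra.
  rewrite in_itv /= => cm gmin; have gc0 : 0 < g c by apply: gpos; lra.
  exists (g c / d / 2); first by rewrite !divr_gt0.
  move=> s sm; apply: (@lt_le_trans _ _ (g c / d)).
    by rewrite ltr_pdivrMr // mulr_natr mulr2n ltrDl divr_gt0.
  by rewrite ler_pM2r ?invr_gt0 //; apply: gmin; rewrite in_itv.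
pose Z := Num.sqrt (m + 2^-1); pose Z1 := Num.sqrt (m + 4^-1).
have ZE : Z ^+ 2 = m + 2^-1 by rewrite sqr_sqrtr //; lra.
have Z1E : Z1 ^+ 2 = m + 4^-1 by rewrite sqr_sqrtr //; lra.
have Z1Z : 0 < Z1 < Z by rewrite sqrtr_gt0 ltr_sqrt //; lra.
pose q z := (g (m - z ^+ 2) / d - e) / 2; pose k z := Num.sqrt (q z).
have zZ2 z : - Z <= z <= Z -> z ^+ 2 <= m + 2^-1.
  by move=> zZ; rewrite -ZE -subr_ge0 subr_sqr mulr_ge0 //; lra.
have q0 z : - Z <= z <= Z -> 0 < q z.
  move=> /zZ2 zZ; rewrite /q divr_gt0 // subr_gt0 eg //.
  by have := sqr_ge0 z; lra.
have k0 z : - Z <= z <= Z -> 0 < k z by move=> /q0; rewrite sqrtr_gt0.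
have q_cont z : - Z <= z <= Z -> {for z, continuous q}.
  move=> /zZ2 zZ; have gz : {for z, continuous (g \o (fun t => m - t ^+ 2))}.
    apply: continuous_comp; last by apply: gcont; have := sqr_ge0 z; lra.
    exact: is_derive_continuous
      (is_derive_subf (is_derive_cstf z m) (is_derive_sqrf (is_derive_idf z))).
  apply: cvgM; last exact: cvg_cst.
  apply: cvgB; last exact: cvg_cst.
  by apply: cvgM; [exact: gz|exact: cvg_cst].
have k_cont z : - Z <= z <= Z -> {for z, continuous k}.
  move=> zZ; apply: continuous_comp; [exact: q_cont|exact: sqrt_continuous].
have [z zZ|a [b [y [ab ya yb y0 yP]]]] := autonomous_ode Z1Z (k := k).
  by split; [exact: k0|exact: k_cont].
(* The slope of psi is -2 p(y) with p(z) = z k(z); at the peak z = 0 only the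
   continuity of k is available. *)
pose p z := z * k z; pose p' z := (f (m - z ^+ 2) / d - e) / 2 / k z.
have pP z : - Z <= z <= Z -> is_derive z 1 p (p' z).
  move=> zZ; have kz := k0 _ zZ; have kk : k z ^+ 2 = q z.
    by rewrite sqr_sqrtr // ltW // q0.
  have [zE|z0] := eqVneq z 0.
    apply/is_derive1_caratheodory; exists k; split.
    - by move=> t; rewrite /p zE mul0r !subr0 mulrC.
    - exact: k_cont.
    - apply: (mulIf (lt0r_neq0 kz)); rewrite -expr2 kk /p' divfK ?gt_eqF //.
      by rewrite /q zE expr0n /= subr0 gm.
  have sK : -1 < m - z ^+ 2 < K + 1 by have := zZ2 _ zZ; have := sqr_ge0 z; lra.
  have sm : m - z ^+ 2 != m.
    by rewrite -subr_eq0 addrAC subrr add0r oppr_eq0 sqrf_eq0.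
  have gz : is_derive z 1 (fun t => g (m - t ^+ 2)) _ :=
    @is_derive1_comp _ g (fun t => m - t ^+ 2) z _ _ (gd _ sK sm)
      (is_derive_subf (is_derive_cstf z m) (is_derive_sqrf (is_derive_idf z))).
  have qz : is_derive z 1 q _ := is_derive_mulf (is_derive_subf
    (is_derive_mulf gz (is_derive_cstf z d^-1)) (is_derive_cstf z e))
    (is_derive_cstf z 2^-1).
  have kz' : is_derive z 1 k _ :=
    @is_derive1_comp _ Num.sqrt q z _ _ (is_derive1_sqrt (q0 _ zZ)) qz.
  apply: (is_derive_eq (is_derive_mulf (is_derive_idf z) kz')).
  have kE : k z = q z / k z by rewrite -kk expr2 mulfK // gt_eqF.
  rewrite -/(k z) /p' [X in 1 * X + _]kE {1}/q.
  move: kz; set G := g _; set Fz := f _; move: (k z) => c c0; field.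
  by rewrite subr_eq0 sm !gt_eqF.
have psid x : a <= x <= b ->
    is_derive x 1 (fun x => m - y x ^+ 2) (- 2 * p (y x)).
  move=> /yP[_ yd].
  apply: (is_derive_eq (is_derive_subf (is_derive_cstf x m) (is_derive_sqrf yd))).
  by rewrite /p; ring.
have [||psi psic psiE] :=
  @continuous_extension_segment R (fun x => m - y x ^+ 2) a b.
- lra.
- by move=> x /psid; exact: is_derive_continuous.
exists m, a, b, psi, (fun x => - 2 * p (y x)),
  (fun x => - 2 * (p' (y x) * k (y x))); split.
- lra.
- by [].
- by rewrite !psiE ?ya ?yb ?sqrrN ?Z1E; lra.
- by rewrite psiE ?y0 ?expr0n /=; lra.
split; [exact: psic|by move=> x xab; rewrite psiE // gerBl sqr_ge0|move=> x xab].
have [|yZ yd] := yP x; first lra.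
have {}yZ : - Z <= y x <= Z by lra.
split.
- apply: (@near_eq_is_derive _ _ _ (fun x => m - y x ^+ 2)).
    have : x \in `]a, b[ by rewrite in_itv.
    move/near_in_itvoo; apply: filterS => t; rewrite in_itv /= => tab.
    by rewrite psiE //; lra.
  by apply: psid; lra.
- by apply: is_derive_Mlf; exact: is_derive1_comp (pP _ yZ) yd.
rewrite psiE; last lra.
rewrite /p' divfK ?gt_eqF ?k0 //; set Fz := f _.
have -> : d * (- 2 * ((Fz / d - e) / 2)) + Fz = d * e by field; rewrite gt_eqF.
exact: mulr_gt0.
Unshelve. all: by end_near. Qed.

(** * Comparison with strict subsolutions *)

Lemma within_continuous_extension (T U V : topologicalType) (A : set U)
    (f : U -> V) (h : T -> U) :
  {within A, continuous f} -> continuous h -> (forall x, A (h x)) ->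
  continuous (f \o h).
Proof.
move=> /subspace_continuousP fA hc hA x.
have hx : h @ x --> within A (nbhs (h x)).
  move=> B nB; have hB : \forall t \near x, A (h t) -> B (h t) := hc x _ nB.
  by apply: filterS hB => t; apply; exact: hA.
exact: cvg_comp hx (fA _ (hA x)).
Qed.

(** At the minimum of the time coordinate over the compact set where [w <= 0],
    [w] vanishes, and it was positive before. *)
Lemma first_touch (R : realType) (w : R * R -> R) (T0 T1 a b : R) :
  continuous w ->
  (forall x, a <= x <= b -> 0 < w (T0, x)) ->
  (forall t, T0 <= t <= T1 -> 0 < w (t, a) /\ 0 < w (t, b)) ->
  (exists t x, [/\ T0 <= t <= T1, a <= x <= b & w (t, x) <= 0]) ->
  exists t x, [/\ T0 < t <= T1, a < x < b, w (t, x) = 0,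
    forall y, a <= y <= b -> 0 <= w (t, y) &
    forall s, T0 <= s <= t -> 0 <= w (s, x)].
Proof.
move=> wc w0 wab [t1 [x1 [t1T x1ab w1]]].
pose Z := (`[T0, T1] `*` `[a, b]) `&` [set z | w z <= 0].
have ZE t x : Z (t, x) <-> [/\ T0 <= t <= T1, a <= x <= b & w (t, x) <= 0].
  by rewrite /Z /= !in_itv /=; split=> [[[]]|[]].
have Zc : compact Z.
  apply: compact_closedI; first by apply: compact_setX; exact: segment_compact.
  apply: (@closed_comp _ _ w [set x | x <= 0]); first by move=> z _; exact: wc.
  exact: closed_le.
have [||[t x] /[!inE] /ZE[tT xab wtx] tmin] := @compact_EVT_min _ R fst Z _ Zc.
- by exists (t1, x1); apply/ZE.
- by apply: continuous_subspaceT => z; exact: cvg_fst.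
have {}tmin s y : T0 <= s <= T1 -> a <= y <= b -> s < t -> 0 < w (s, y).
  move=> sT yab st; rewrite ltNge; apply/negP => wsy.
  by have : (s, y) \in Z; [rewrite inE; apply/ZE|move/tmin => /=; lra].
have T0t : T0 < t.
  rewrite lt_neqAle; case/andP: (tT) => -> _; rewrite andbT.
  by apply/eqP => T0E; have := w0 x xab; rewrite T0E; lra.
have ax : a < x.
  rewrite lt_neqAle; case/andP: (xab) => -> _; rewrite andbT.
  by apply/eqP => aE; have [] := wab t tT; rewrite aE; lra.
have xb : x < b.
  rewrite lt_neqAle; case/andP: (xab) => _ ->; rewrite andbT.
  by apply/eqP => bE; have [] := wab t tT; rewrite -bE; lra.
have wt y : a <= y <= b -> 0 <= w (t, y).
  move=> yab; have wl : w (s, y) @[s --> t^'-] --> w (t, y).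
    apply: cvg_at_left_filter.
    apply: (@continuous_comp _ _ _ (fun s => (s, y)) w); last exact: wc.
    exact: cvg_pair (@cvg_id _ _) (@cvg_cst _ _ _ _ _).
  rewrite leNgt; apply/negP => wty.
  have : \forall s \near t^'-, [/\ w (s, y) < 0, T0 < s & s < t].
    near=> s; split; near: s; first exact: (cvgr_lt _ wl).
      exact: nbhs_left_gt.
    exact: nbhs_left_lt.
  case/(@filter_ex _ _ (at_left_proper_filter t)) => s [ws T0s st].
  by have : 0 < w (s, y); [apply: tmin|]; lra.
have wtx0 : w (t, x) = 0 by apply/eqP; rewrite eq_le wtx wt.
exists t, x; split=> //; rewrite ?T0t ?ax ?xb //; first by case/andP: tT.
move=> s sT; have [->|st] := eqVneq s t; first by rewrite wtx0.
apply/ltW/tmin => //; first by lra.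
by rewrite lt_neqAle st; lra.
Unshelve. all: by end_near. Qed.

(** * Geometry of the patches and regularity of solutions *)

Section Patches.
Context (R : realType) (l1 l2 : R) (l1_gt0 : 0 < l1) (l2_gt0 : 0 < l2).
Let l := l1 + l2.

Let l_gt0 : 0 < l. Proof. exact: addr_gt0. Qed.

Lemma patch_cover x : [\/ exists n, patch1 l1 l2 n x, exists n, patch2 l1 l2 n x,
  S1 l1 l2 x | S2 l1 l2 x].
Proof.
pose n := Num.floor (x / l).
have nx : n%:~R * l <= x by rewrite -ler_pdivlMr // floor_le.
have xn : x < (n + 1)%:~R * l by rewrite -ltr_pdivrMr // floorD1_gt.
have nE : (n + 1)%:~R * l = n%:~R * l + l by rewrite intrD mulrDl mul1r.
have [xE|xnE] := eqVneq x (n%:~R * l); first by apply: Or43; exists n.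
have [xl2|l2x|xE] := ltgtP x (n%:~R * l + l2).
- apply: Or42; exists n; rewrite /patch2 /= in_itv /= xl2 andbT.
  by rewrite lt_neqAle eq_sym xnE.
- apply: Or41; exists (n + 1); rewrite /patch1 /= in_itv /= xn andbT nE.
  by rewrite /l addrA addrAC addrK -/l.
- by apply: Or44; exists n.
Qed.

Let int_gap (n m : int) : n%:~R * l < m%:~R * l -> n%:~R * l + l <= m%:~R * l.
Proof.
rewrite ltr_pM2r // ltr_int -lezD1 -(ler_int R) intrD -(ler_pM2r l_gt0).
by rewrite mulrDl mul1r.
Qed.

Lemma patch12_disjoint n m x : patch1 l1 l2 n x -> patch2 l1 l2 m x -> False.
Proof.
rewrite /patch1 /patch2 /= !in_itv /= -/l => xn xm.
have [|] := ltP (m%:~R * l) (n%:~R * l); last lra.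
by move/int_gap; rewrite /l in xn xm *; lra.
Qed.

Lemma patch1_not_interface n x :
  patch1 l1 l2 n x -> ~ (S1 l1 l2 `|` S2 l1 l2) x.
Proof.
rewrite /patch1 /= in_itv /= -/l => xn [[m]|[m]]; rewrite -/l => xE;
  move: l1_gt0 l2_gt0 => ? ?.
  have [|] := ltP (m%:~R * l) (n%:~R * l); last lra.
  by move/int_gap; rewrite /l in xn xE *; lra.
have [|] := ltP (m%:~R * l) (n%:~R * l); last lra.
by move/int_gap; rewrite /l in xn xE *; lra.
Qed.

Lemma patch2_not_interface n x :
  patch2 l1 l2 n x -> ~ (S1 l1 l2 `|` S2 l1 l2) x.
Proof.
rewrite /patch2 /= in_itv /= -/l => xn [[m]|[m]]; rewrite -/l => xE;
  move: l1_gt0 l2_gt0 => ? ?.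
  have [|] := ltP (n%:~R * l) (m%:~R * l); last lra.
  by move/int_gap; rewrite /l in xn xE *; lra.
have [|] := ltP (n%:~R * l) (m%:~R * l).
  by move/int_gap; rewrite /l in xn xE *; lra.
rewrite le_eqVlt => /predU1P[|/int_gap]; rewrite /l in xn xE *; lra.
Qed.

Lemma in_bigcup_patch1 n x : patch1 l1 l2 n x -> x \in \bigcup_n patch1 l1 l2 n.
Proof. by move=> xn; rewrite inE; exists n. Qed.

Lemma notin_bigcup_patch1 n x :
  patch2 l1 l2 n x -> (x \in \bigcup_n patch1 l1 l2 n) = false.
Proof.
move=> xn; apply/negbTE; rewrite notin_setE => -[m _ xm].
exact: patch12_disjoint xm xn.
Qed.

End Patches.

Lemma C12_is_derive (R : realType) (u : R -> R -> R) (a b t x : R) :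
  C12 u a b -> 0 < t -> a < x < b ->
  [/\ is_derive t 1 (fun s => u s x) (derive1 (fun s => u s x) t),
      is_derive x 1 (u t) (derive1 (u t) x) &
      is_derive x 1 (derive1 (u t)) (derive1 (derive1 (u t)) x)].
Proof.
move=> [ut [ux [uxx [_ _ _ utd uxd]]]] t0 xab.
have dux y : a < y < b -> is_derive y 1 (u t) (derive1 (u t) y).
  by move=> /(uxd t y t0)[[duy _] _]; rewrite derive1E; exact/derivableP.
have ux_near : \forall y \near x, ux t y = derive1 (u t) y.
  have : x \in `]a, b[ by rewrite in_itv.
  move/near_in_itvoo; apply: filterS => y; rewrite in_itv /=.
  by move=> /(uxd t y t0)[[_ uy] _]; rewrite derive1E.
split; last 1 first.
- have [_ /(near_eq_is_derive ux_near)[duxx _]] := uxd t x t0 xab.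
  by rewrite derive1E; exact/derivableP.
- rewrite derive1E; apply/derivableP; have [|//] := utd t x t0; lra.
- exact: dux.
Qed.

Definition strict_sub (R : realType) (d : R) (f : R -> R) (phi : R -> R -> R)
    (t x : R) :=
  exists (phit : R) (phix : R -> R) (phixx : R),
    [/\ is_derive t 1 (fun s => phi s x) phit,
        \forall y \near x, is_derive (y : R) 1 (phi t) (phix y),
        is_derive x 1 phix phixx & phit < d * phixx + f (phi t x)].

(** The one-sided values of the flux [p v'] of [v] at an interface with weights
    [p] on its left and [q] on its right. *)
Definition has_flux (R : realType) (p q : R) (v : R -> R) (x fl fr : R) :=
  exists (vl vr : R -> R) (c c' : R),
    [/\ \forall y \near x^'-, is_derive (y : R) 1 v (vl y),
        \forall y \near x^'+, is_derive (y : R) 1 v (vr y),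
        vl y @[y --> x^'-] --> c, vr y @[y --> x^'+] --> c' &
        p * c = fl /\ q * c' = fr].

Definition strict_kink (R : realType) (p q : R) (v : R -> R) (x : R) :=
  exists fl fr, has_flux p q v x fl fr /\ fl < fr.

(** Where a strict subsolution touches [u] from below for the first time, the
    equation for [u] is violated. *)
Lemma touch_regular (R : realType) (d : R) (f : R -> R) (u phi : R -> R -> R)
    (T0 t x ut uxx : R) (ux : R -> R) : 0 < d -> T0 < t ->
  strict_sub d f phi t x ->
  (\forall y \near x, is_derive (y : R) 1 (u t) (ux y)) ->
  is_derive x 1 ux uxx ->
  is_derive t 1 (fun s => u s x) ut ->
  ut = d * uxx + f (u t x) ->
  u t x = phi t x ->
  (\forall y \near x, phi t y <= u t y) ->
  (forall s, T0 <= s <= t -> phi s x <= u s x) -> False.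
Proof.
move=> d0 T0t [pt [px [pxx [dpt dpx dpxx sub]]]] dux duxx dut pde uE xmin tmin.
have wxx : 0 <= uxx - pxx.
  apply: (@min_second_derivative_ge0 R (fun y => u t y - phi t y)
    (fun y => ux y - px y) x).
  - by apply: filterS2 dux dpx => y uy py; exact (is_derive_subf uy py).
  - by near=> y; rewrite uE subrr subr_ge0; near: y.
have dw : is_derive t 1 (fun s => u s x - phi s x) _ := is_derive_subf dut dpt.
have wt : ut - pt <= 0.
  have [dw1 dwE] := dw; rewrite leNgt; apply/negP => w0.
  have : h^-1 *: ((u (h *: 1 + t) x - phi (h *: 1 + t) x) - (u t x - phi t x))
      @[h --> 0^'] --> ut - pt.
    by rewrite -dwE; exact: dw1.
  move/(@cvgr_gt _ _ _ _ _)/(_ _ w0) => /nbhs_ballP[e /= e0 ball_e].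
  pose h := Order.min (e / 2) (t - T0).
  have h0 : 0 < h by rewrite lt_min divr_gt0 //= subr_gt0.
  have he : h <= e / 2 by rewrite ge_min lexx.
  have ht : h <= t - T0 by rewrite ge_min lexx orbT.
  have : 0 < (- h)^-1 *: ((u (- h *: 1 + t) x - phi (- h *: 1 + t) x) -
      (u t x - phi t x)).
    apply: ball_e => /=; last by rewrite oppr_eq0 gt_eqF.
    by rewrite /ball /= sub0r opprK gtr0_norm //; lra.
  rewrite uE subrr subr0 /GRing.scale /= mulr1.
  rewrite nmulr_rgt0 ?invr_lt0 ?oppr_lt0 // subr_lt0 ltNge tmin //.
  by rewrite -/h; lra.
have : d * pxx <= d * uxx by rewrite ler_pM2l //; lra.
by move: sub wt pde; rewrite uE; lra.
Unshelve. all: by end_near. Qed.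

(** At a minimum of [v - phi] its one-sided slopes have opposite signs, so the
    flux of [v] jumps upwards at least as much as that of [phi]; but the flux of
    [v] is continuous. *)
Lemma touch_interface (R : realType) (p q : R) (v v' phi : R -> R) (x e e' : R) :
  0 < p -> 0 < q -> strict_kink p q phi x ->
  v' y @[y --> x^'-] --> e -> v' y @[y --> x^'+] --> e' -> p * e = q * e' ->
  {for x, continuous v} -> {for x, continuous phi} ->
  (\forall y \near x^'-, is_derive (y : R) 1 v (v' y)) ->
  (\forall y \near x^'+, is_derive (y : R) 1 v (v' y)) ->
  v x = phi x -> (\forall y \near x, phi y <= v y) -> False.
Proof.
move=> p0 q0 [fl [fr [[vl [vr [c [c' [dvl dvr vlc vrc' [<- <-]]]]]] kink]]].
move=> ve ve' flux vc phic dl dr vE vmin.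
have wc : {for x, continuous (fun y => v y - phi y)} by exact: cvgB.
have ec : e - c <= 0.
  apply: (min_left_slope_le0 wc (w' := fun y => v' y - vl y)).
  - by apply: filterS2 dl dvl => y uy py; exact (is_derive_subf uy py).
  - exact: cvgB.
  - by near=> y; rewrite vE subrr subr_ge0; near: y; apply: cvg_within.
have ec' : 0 <= e' - c'.
  apply: (min_right_slope_ge0 wc (w' := fun y => v' y - vr y)).
  - by apply: filterS2 dr dvr => y uy py; exact (is_derive_subf uy py).
  - exact: cvgB.
  - by near=> y; rewrite vE subrr subr_ge0; near: y; apply: cvg_within.
have : p * e <= p * c by rewrite ler_pM2l //; lra.
have : q * c' <= q * e' by rewrite ler_pM2l //; lra.
lra.
Unshelve. all: by end_near. Qed.

Section Comparison.
Context (R : realType) (l1 l2 d1 d2 sigma : R) (f1 f2 u0 : R -> R).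
Context (u : R -> R -> R) (l1_gt0 : 0 < l1) (l2_gt0 : 0 < l2).
Context (sigma_gt0 : 0 < sigma).
Context (sol : patch_solution l1 l2 d1 d2 sigma f1 f2 u0 u).
Let l := l1 + l2.

Lemma sol_patch1 n t x : 0 < t -> patch1 l1 l2 n x ->
  derive1 (fun s => u s x) t = d1 * derive1 (derive1 (u t)) x + f1 (u t x).
Proof.
move=> t0 xn; have := sol_pde sol t0 (patch1_not_interface l1_gt0 l2_gt0 xn).
by rewrite /diffusivity /reaction (in_bigcup_patch1 xn) => <-; ring.
Qed.

Lemma sol_patch2 n t x : 0 < t -> patch2 l1 l2 n x ->
  derive1 (fun s => u s x) t = d2 * derive1 (derive1 (u t)) x + f2 (u t x).
Proof.
move=> t0 xn; have := sol_pde sol t0 (patch2_not_interface l1_gt0 l2_gt0 xn).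
rewrite /diffusivity /reaction (notin_bigcup_patch1 l1_gt0 l2_gt0 xn) => <-.
by ring.
Qed.

Lemma near_patch1 n x : patch1 l1 l2 n x -> \forall y \near x, patch1 l1 l2 n y.
Proof. exact: near_in_itvoo. Qed.

Lemma near_patch2 n x : patch2 l1 l2 n x -> \forall y \near x, patch2 l1 l2 n y.
Proof. exact: near_in_itvoo. Qed.

Lemma S1_left_patch n : \forall y \near (n%:~R * l)^'-, patch1 l1 l2 n y.
Proof.
near=> y; rewrite /patch1 /= in_itv /= -/l; apply/andP; split; near: y.
  by apply: nbhs_left_gt; rewrite gtrBl.
exact: nbhs_left_lt.
Unshelve. all: by end_near. Qed.

Lemma S1_right_patch n : \forall y \near (n%:~R * l)^'+, patch2 l1 l2 n y.
Proof.
near=> y; rewrite /patch2 /= in_itv /= -/l; apply/andP; split; near: y.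
  exact: nbhs_right_gt.
by apply: nbhs_right_lt; rewrite ltrDl.
Unshelve. all: by end_near. Qed.

Lemma S2_left_patch n : \forall y \near (n%:~R * l + l2)^'-, patch2 l1 l2 n y.
Proof.
near=> y; rewrite /patch2 /= in_itv /= -/l; apply/andP; split; near: y.
  by apply: nbhs_left_gt; rewrite ltrDl.
exact: nbhs_left_lt.
Unshelve. all: by end_near. Qed.

Lemma S2_right_patch n :
  \forall y \near (n%:~R * l + l2)^'+, patch1 l1 l2 (n + 1) y.
Proof.
near=> y; rewrite /patch1 /= in_itv /= -/l intrD mulrDl mul1r.
apply/andP; split; near: y.
  apply: filterS (nbhs_right_gt _) => y; rewrite /l; lra.
by apply: nbhs_right_lt; rewrite /l; move: l1_gt0; lra.
Unshelve. all: by end_near. Qed.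

Lemma sol_derive_patch1 n (t x : R) : 0 < t -> patch1 l1 l2 n x ->
  [/\ is_derive t 1 (fun s => u s x) (derive1 (fun s => u s x) t),
      is_derive x 1 (u t) (derive1 (u t) x) &
      is_derive x 1 (derive1 (u t)) (derive1 (derive1 (u t)) x)].
Proof.
move=> t0; rewrite /patch1 /= in_itv /= => xn.
exact: C12_is_derive (sol_C12_patch1 sol n) t0 xn.
Qed.

Lemma sol_derive_patch2 n (t x : R) : 0 < t -> patch2 l1 l2 n x ->
  [/\ is_derive t 1 (fun s => u s x) (derive1 (fun s => u s x) t),
      is_derive x 1 (u t) (derive1 (u t) x) &
      is_derive x 1 (derive1 (u t)) (derive1 (derive1 (u t)) x)].
Proof.
move=> t0; rewrite /patch2 /= in_itv /= => xn.
exact: C12_is_derive (sol_C12_patch2 sol n) t0 xn.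
Qed.

(** Extending the solution evenly in time makes it continuous on the whole plane,
    as [first_touch] requires. *)
Lemma sol_even_continuous :
  continuous (fun z : R * R => u (`|z.1|) z.2).
Proof.
apply: (@within_continuous_extension _ _ _ _ (fun z : R * R => u z.1 z.2)
  (fun z : R * R => (`|z.1|, z.2)) (sol_continuous sol)).
  move=> z; have z1 : `|w.1| @[w --> z] --> `|z.1|.
    by apply: cvg_norm; exact: cvg_fst.
  exact: cvg_pair z1 cvg_snd.
by move=> z /=.
Qed.

(** The subsolution inequalities are only required at contact points. There
    the reaction terms of [u] and [phi] coincide, and [phi] inherits the bounds
    known for [u]: with [u >= 0], nothing has to be checked where [phi < 0]. *)
Lemma comparison (phi : R -> R -> R) (T0 T1 a b : R) : 0 <= T0 ->
  0 < d1 -> 0 < d2 ->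
  continuous (fun z : R * R => phi z.1 z.2) ->
  (forall x, a <= x <= b -> phi T0 x < u T0 x) ->
  (forall t, T0 <= t <= T1 -> phi t a < u t a /\ phi t b < u t b) ->
  (forall t x, T0 < t <= T1 -> a < x < b -> u t x = phi t x ->
    [/\ forall n, patch1 l1 l2 n x -> strict_sub d1 f1 phi t x,
        forall n, patch2 l1 l2 n x -> strict_sub d2 f2 phi t x,
        S1 l1 l2 x -> strict_kink 1 sigma (phi t) x &
        S2 l1 l2 x -> strict_kink sigma 1 (phi t) x]) ->
  forall t x, T0 <= t <= T1 -> a <= x <= b -> phi t x < u t x.
Proof.
move=> T00 d1_gt0 d2_gt0 phic phi0 phiab sub t1 x1 t1T x1ab.
pose w (z : R * R) := u (`|z.1|) z.2 - phi z.1 z.2.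
have wc : continuous w.
  by move=> z; apply: cvgB; [exact: sol_even_continuous|exact: phic].
have wE t x : 0 <= t -> w (t, x) = u t x - phi t x.
  by move=> t0; rewrite /w /= ger0_norm.
rewrite ltNge; apply/negP => touch.
have [|s sT||t [x [tT xab wtx wxmin wtmin]]] := @first_touch R w T0 T1 a b wc.
- by move=> x xab; rewrite wE // subr_gt0 phi0.
- by rewrite !wE ?subr_gt0; [exact: phiab|lra|lra].
- by exists t1, x1; split; rewrite // wE; lra.
have t0 : 0 < t by lra.
have wtE y := wE t y (ltW t0).
have uE : u t x = phi t x by apply/eqP; rewrite -subr_eq0 -wtE wtx.
have xmin : \forall y \near x, phi t y <= u t y.
  have : x \in `]a, b[ by rewrite in_itv.
  move/near_in_itvoo; apply: filterS => y; rewrite in_itv /= => yab.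
  by rewrite -subr_ge0 -wtE wxmin //; lra.
have tmin s : T0 <= s <= t -> phi s x <= u s x.
  by move=> sT; rewrite -subr_ge0 -wE; [exact: wtmin|lra].
have slice : {for x, continuous (fun y : R => (t, y))}.
  exact: cvg_pair (@cvg_cst _ _ _ _ _) (@cvg_id _ _).
have uc : {for x, continuous (u t)}.
  have -> : u t = (fun z : R * R => u `|z.1| z.2) \o (fun y : R => (t, y)).
    by apply/funext => y /=; rewrite gtr0_norm.
  exact: continuous_comp slice (@sol_even_continuous (t, x)).
have pc : {for x, continuous (phi t)} := continuous_comp slice (phic (t, x)).
have [sub1 sub2 kink1 kink2] := sub t x tT xab uE.
case: (patch_cover l1_gt0 l2_gt0 x) => [[n xn]|[n xn]|xS|xS].
- have [dut _ duxx] := sol_derive_patch1 t0 xn.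
  apply: (touch_regular d1_gt0 _ (sub1 n xn) _ duxx dut (sol_patch1 t0 xn)
    uE xmin tmin).
    by lra.
  by apply: filterS (near_patch1 xn) => y /(sol_derive_patch1 t0)[].
- have [dut _ duxx] := sol_derive_patch2 t0 xn.
  apply: (touch_regular d2_gt0 _ (sub2 n xn) _ duxx dut (sol_patch2 t0 xn)
    uE xmin tmin).
    by lra.
  by apply: filterS (near_patch2 xn) => y /(sol_derive_patch2 t0)[].
- have [_ [c [c' [uc1 uc2 flux]]]] := sol_S1 sol t0 xS.
  apply: (touch_interface ltr01 sigma_gt0 (kink1 xS) uc1 uc2 flux uc pc) => //.
    case: xS => n ->; apply: filterS (S1_left_patch n) => y.
    by move/(sol_derive_patch1 t0) => [].
  case: xS => n ->; apply: filterS (S1_right_patch n) => y.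
  by move/(sol_derive_patch2 t0) => [].
have [_ [c [c' [uc1 uc2 flux]]]] := sol_S2 sol t0 xS.
apply: (touch_interface sigma_gt0 ltr01 (kink2 xS) uc1 uc2 flux uc pc) => //.
  case: xS => n ->; apply: filterS (S2_left_patch n) => y.
  by move/(sol_derive_patch2 t0) => [].
case: xS => n ->; apply: filterS (S2_right_patch n) => y.
by move/(sol_derive_patch1 t0) => [].
Qed.

End Comparison.

(** * Exponential profiles adapted to the interfaces *)

Lemma has_flux_affine (R : realType) (p q : R) (v : R -> R) (x fl fr al be : R) :
  has_flux p q v x fl fr ->
  has_flux p q (fun y => al + be * v y) x (be * fl) (be * fr).
Proof.
move=> [vl [vr [c [c' [dvl dvr vlc vrc' [<- <-]]]]]].
exists (fun y => be * vl y), (fun y => be * vr y), (be * c), (be * c').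
have aff (y a : R) : is_derive y 1 v a ->
    is_derive y 1 (fun z => al + be * v z) (be * a).
  move=> dv; rewrite -[be * a]add0r.
  exact (is_derive_addf (is_derive_cstf y al) (is_derive_Mlf be dv)).
split; last by split; ring.
- by apply: filterS dvl => y; exact: aff.
- by apply: filterS dvr => y; exact: aff.
- by apply: cvgM => //; exact: cvg_cst.
- by apply: cvgM => //; exact: cvg_cst.
Qed.

Lemma has_flux_add (R : realType) (p q : R) (v w : R -> R)
    (x fl fr gl gr : R) :
  has_flux p q v x fl fr -> has_flux p q w x gl gr ->
  has_flux p q (fun y => v y + w y) x (fl + gl) (fr + gr).
Proof.
move=> [vl [vr [c [c' [dvl dvr vlc vrc' [<- <-]]]]]].
move=> [wl [wr [e [e' [dwl dwr wle wre' [<- <-]]]]]].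
exists (fun y => vl y + wl y), (fun y => vr y + wr y), (c + e), (c' + e').
split; last by split; ring.
- by apply: filterS2 dvl dwl => y dv dw; exact (is_derive_addf dv dw).
- by apply: filterS2 dvr dwr => y dv dw; exact (is_derive_addf dv dw).
- exact: cvgD.
- exact: cvgD.
Qed.

Lemma glued_inside (R : realType) (h H : R -> R) (A B x a : R) :
  A < x < B -> (forall y, A <= y <= B -> h y = H y) ->
  is_derive x 1 H a -> is_derive x 1 h a.
Proof.
move=> xAB hH; apply: near_eq_is_derive.
have : x \in `]A, B[ by rewrite in_itv.
move/near_in_itvoo; apply: filterS => y; rewrite in_itv /= => yAB.
by rewrite hH //; lra.
Qed.

Lemma glued_continuous (R : realType) (h HL HR : R -> R) (A B x : R) :
  A < x < B -> (forall y, A <= y <= x -> h y = HL y) ->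
  (forall y, x <= y <= B -> h y = HR y) ->
  {for x, continuous HL} -> {for x, continuous HR} -> {for x, continuous h}.
Proof.
move=> /andP[Ax xB] hL hR HLc HRc; apply/left_right_continuousP; split.
  rewrite hL ?lexx ?ltW //; apply: cvg_trans (cvg_at_left_filter HLc).
  apply: near_eq_cvg; near=> y; rewrite hL //.
  by apply/andP; split; apply: ltW; near: y; [exact: nbhs_left_gt|exact: nbhs_left_lt].
rewrite hR ?lexx ?ltW //; apply: cvg_trans (cvg_at_right_filter HRc).
apply: near_eq_cvg; near=> y; rewrite hR //.
by apply/andP; split; apply: ltW; near: y; [exact: nbhs_right_gt|exact: nbhs_right_lt].
Unshelve. all: by end_near. Qed.

Lemma glued_flux (R : realType) (p q : R) (h HL HL' HR HR' : R -> R) (A B x : R) :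
  A < x < B -> (forall y, A <= y <= x -> h y = HL y) ->
  (forall y, x <= y <= B -> h y = HR y) ->
  (forall y : R, is_derive y 1 HL (HL' y)) ->
  (forall y : R, is_derive y 1 HR (HR' y)) ->
  {for x, continuous HL'} -> {for x, continuous HR'} ->
  has_flux p q h x (p * HL' x) (q * HR' x).
Proof.
move=> /andP[Ax xB] hL hR dL dR HLc HRc.
exists HL', HR', (HL' x), (HR' x); split=> //.
- have : \forall y \near x^'-, A < y < x.
    near=> y; apply/andP; split; near: y; [exact: nbhs_left_gt|exact: nbhs_left_lt].
  by apply: filterS => y yx; apply: glued_inside yx hL (dL y).
- have : \forall y \near x^'+, x < y < B.
    near=> y; apply/andP; split; near: y; [exact: nbhs_right_gt|exact: nbhs_right_lt].
  by apply: filterS => y yx; apply: glued_inside yx hR (dR y).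
- exact: cvg_at_left_filter.
- exact: cvg_at_right_filter.
Unshelve. all: by end_near. Qed.

(** On a patch [[A, B]] with flux weight [p], the first term is affine with flux
    [s]; the second one vanishes at both ends, where its flux is [- rho] and
    [rho]. *)
Definition ramp (R : realType) (s rho yA A B p x : R) : R :=
  s * (yA + (x - A) / p) + rho * ((x - A) * (x - B) / ((B - A) * p)).

Lemma ramp_endr (R : realType) (s rho yA A B p : R) : A < B ->
  ramp s rho yA A B p B = s * (yA + (B - A) / p).
Proof. by move=> AB; rewrite /ramp subrr mulr0 mul0r mulr0 addr0. Qed.

Lemma ramp_endl (R : realType) (s rho yA A B p : R) :
  ramp s rho yA A B p A = s * yA.
Proof. by rewrite /ramp subrr !mul0r mulr0 !addr0. Qed.

Definition ramp_slope (R : realType) (s rho A B p x : R) : R :=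
  (s + rho * (((x - A) + (x - B)) / (B - A))) / p.

Lemma is_derive_ramp (R : realType) (s rho yA A B p x : R) : A < B -> 0 < p ->
  is_derive x 1 (ramp s rho yA A B p) (ramp_slope s rho A B p x).
Proof.
move=> AB p0; have AB0 : B - A != 0 by rewrite gt_eqF // subr_gt0.
have dA := is_derive_subf (is_derive_idf x) (is_derive_cstf x A).
have dB := is_derive_subf (is_derive_idf x) (is_derive_cstf x B).
apply: (is_derive_eq (is_derive_addf
  (is_derive_Mlf s (is_derive_addf (is_derive_cstf x yA)
    (is_derive_mulf dA (is_derive_cstf x p^-1))))
  (is_derive_Mlf rho (is_derive_mulf (is_derive_mulf dA dB)
    (is_derive_cstf x ((B - A) * p)^-1))))).
by rewrite /ramp_slope; field; rewrite AB0 gt_eqF.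
Qed.

Lemma is_derive_ramp_slope (R : realType) (s rho A B p x : R) : A < B -> 0 < p ->
  is_derive x 1 (ramp_slope s rho A B p) (2 * rho / ((B - A) * p)).
Proof.
move=> AB p0; have AB0 : B - A != 0 by rewrite gt_eqF // subr_gt0.
have dA := is_derive_subf (is_derive_idf x) (is_derive_cstf x A).
have dB := is_derive_subf (is_derive_idf x) (is_derive_cstf x B).
apply: (is_derive_eq (is_derive_mulf (is_derive_addf (is_derive_cstf x s)
  (is_derive_Mlf rho (is_derive_mulf (is_derive_addf dA dB)
    (is_derive_cstf x (B - A)^-1)))) (is_derive_cstf x p^-1))).
by field; rewrite AB0 gt_eqF.
Qed.

Lemma is_derive_exp_ramp (R : realType) (k s rho yA A B p x : R) : A < B ->
  0 < p -> is_derive x 1 (fun y => expR (k * ramp s rho yA A B p y))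
    (expR (k * ramp s rho yA A B p x) * (k * ramp_slope s rho A B p x)).
Proof.
move=> AB p0.
exact (is_derive_expf (is_derive_Mlf k (is_derive_ramp s rho yA x AB p0))).
Qed.

Lemma is_derive2_exp_ramp (R : realType) (k s rho yA A B p x : R) : A < B ->
  0 < p -> is_derive x 1 (fun y => expR (k * ramp s rho yA A B p y) *
      (k * ramp_slope s rho A B p y))
    ((k ^+ 2 * ramp_slope s rho A B p x ^+ 2 + k * (2 * rho / ((B - A) * p))) *
      expR (k * ramp s rho yA A B p x)).
Proof.
move=> AB p0; apply: (is_derive_eq (is_derive_mulf
  (is_derive_exp_ramp k s rho yA x AB p0)
  (is_derive_Mlf k (is_derive_ramp_slope s rho x AB p0)))).
by ring.
Qed.

Lemma ramp_slope_bounds (R : realType) (s rho A B p x : R) : A < x < B ->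
  0 < p -> `|s| = 1 -> `|rho| = 2^-1 ->
  (4 * p ^+ 2)^-1 <= ramp_slope s rho A B p x ^+ 2 <= 9 / (4 * p ^+ 2).
Proof.
move=> /andP[Ax xB] p0 s1 rho2; have AB : 0 < B - A by lra.
set th := ((x - A) + (x - B)) / (B - A).
have th1 : -1 <= th <= 1.
  by rewrite /th ler_pdivlMr // ler_pdivrMr //; lra.
have slopeE : ramp_slope s rho A B p x = (s + rho * th) / p by [].
have -> : (4 * p ^+ 2)^-1 = 4^-1 * p^-1 ^+ 2 by rewrite invfM exprVn.
rewrite [9 * _]mulrA slopeE exprMn !ler_pM2r ?exprn_gt0 ?invr_gt0 //.
have : s = 1 \/ s = -1.
  by case: (ger0P s) s1 => _ sE; [left|right]; lra.
have : rho = 2^-1 \/ rho = - 2^-1.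
  by case: (ger0P rho) rho2 => _ sE; [left|right]; lra.
by move=> [->|->] [->|->]; apply/andP; split; nra.
Qed.

Lemma ramp_close (R : realType) (s rho yA A B p x c D : R) : A <= x <= B ->
  A < B -> 0 < p -> `|s| = 1 -> `|rho| = 2^-1 ->
  (B - A) / p <= D -> `|yA + (x - A) / p - c| <= D ->
  `|ramp s rho yA A B p x - s * c| <= 2 * D.
Proof.
move=> xAB AB p0 s1 rho2 BD cD.
have -> : ramp s rho yA A B p x - s * c = s * (yA + (x - A) / p - c) +
    rho * ((x - A) * (x - B) / ((B - A) * p)) by rewrite /ramp; ring.
apply: (le_trans (ler_normD _ _)); rewrite !normrM s1 rho2 mul1r.
have BA : 0 < B - A by rewrite subr_gt0.
have : `|x - A| * `|x - B| * `|((B - A) * p)^-1| <= D.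
  apply: le_trans BD; rewrite normfV normrM (gtr0_norm BA) (gtr0_norm p0) invfM.
  rewrite mulrA ler_pM2r ?invr_gt0 // ler_pdivrMr //.
  by apply: ler_pM => //; [rewrite ger0_norm; lra|rewrite ler0_norm; lra].
have : 0 <= D by apply: le_trans cD.
lra.
Qed.

Section Profile.
Context (R : realType) (l1 l2 sigma : R).
Context (l1_gt0 : 0 < l1) (l2_gt0 : 0 < l2) (sigma_gt0 : 0 < sigma).
Let l := l1 + l2.

(** The increase over one period of the coordinate [y] with [y' = 1 / p]. *)
Definition period_increment := l2 / sigma + l1.
Let Y := period_increment.

Definition ramp2 (s rho : R) (n : int) :=
  ramp s rho (n%:~R * Y) (n%:~R * l) (n%:~R * l + l2) sigma.

Definition ramp1 (s rho : R) (n : int) :=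
  ramp s rho (n%:~R * Y - l1) (n%:~R * l - l1) (n%:~R * l) 1.

(** The ramps glued into a continuous function. At every interface its flux is
    [s + rho] on the left and [s - rho] on the right: the sign of [s] is the
    direction in which the phase grows at large scale, and the sign of [rho]
    decides whether the kinks point downwards or upwards. *)
Definition phase (s rho x : R) : R :=
  let n := Num.floor (x / l) in
  if x <= n%:~R * l + l2 then ramp2 s rho n x else ramp1 s rho (n + 1) x.

Let l_gt0 : 0 < l. Proof. exact: addr_gt0. Qed.

Lemma phase2E s rho n x : n%:~R * l <= x <= n%:~R * l + l2 ->
  phase s rho x = ramp2 s rho n x.
Proof.
move=> xn; have nE : Num.floor (x / l) = n.
  apply: floor_def; rewrite ler_pdivlMr // ltr_pdivrMr // intrD mulrDl mul1r.
  by move: l1_gt0 xn; rewrite /l; lra.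
by rewrite /phase nE; case/andP: xn => _ ->.
Qed.

Lemma phase1E s rho n x : n%:~R * l - l1 <= x <= n%:~R * l ->
  phase s rho x = ramp1 s rho n x.
Proof.
move=> xn; have n1E : (n - 1)%:~R * l + l2 = n%:~R * l - l1.
  by rewrite intrB /l; ring.
have [->|xne] := eqVneq x (n%:~R * l).
  rewrite (@phase2E _ _ n); last by move: l2_gt0; lra.
  rewrite /ramp2 /ramp1 ramp_endl ramp_endr; last by move: l1_gt0; lra.
  by congr (_ * _); rewrite divr1; ring.
have [xE|xne'] := eqVneq x (n%:~R * l - l1).
  rewrite xE (@phase2E _ _ (n - 1)); last by move: n1E l2_gt0; lra.
  rewrite /ramp1 /ramp2 ramp_endl -n1E ramp_endr; last by move: l2_gt0; lra.
  congr (_ * _); rewrite intrB /Y /period_increment; ring.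
have nE : Num.floor (x / l) = n - 1.
  apply: floor_def; rewrite ler_pdivlMr // ltr_pdivrMr // subrK lt_neqAle xne.
  by move: l2_gt0 n1E xn; lra.
rewrite /phase nE subrK n1E leNgt lt_neqAle eq_sym xne' /=.
by case/andP: xn => ->.
Qed.

(** At large scale the phase is linear. *)
Lemma phase_close s rho x : `|s| = 1 -> `|rho| = 2^-1 ->
  `|phase s rho x - s * (Y / l * x)| <= 2 * Y.
Proof.
move=> s1 rho2; pose n := Num.floor (x / l).
have nx : n%:~R * l <= x by rewrite -ler_pdivlMr // floor_le.
have xn : x < (n + 1)%:~R * l by rewrite -ltr_pdivrMr // floorD1_gt.
have nE : (n + 1)%:~R * l = n%:~R * l + l by rewrite intrD mulrDl mul1r.
have nYE : (n + 1)%:~R * Y = n%:~R * Y + Y by rewrite intrD mulrDl mul1r.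
have l2s : 0 < l2 / sigma by rewrite divr_gt0.
have Y0 : 0 < Y by rewrite /Y /period_increment addr_gt0.
(* both coordinates lie in the n-th period [n Y, n Y + Y] *)
have lin : n%:~R * Y <= Y / l * x <= n%:~R * Y + Y.
  have YE (z : R) : z * Y = Y / l * (z * l) by field; rewrite gt_eqF.
  by rewrite -nYE !YE !ler_pM2l ?divr_gt0 //; lra.
have [xl2|l2x] := leP x (n%:~R * l + l2).
  rewrite (@phase2E _ _ n); last by rewrite nx.
  apply: ramp_close => //; [lra|by rewrite ltrDl| |].
    by rewrite addrAC subrr add0r /Y /period_increment; move: l1_gt0; lra.
  have y0 : 0 <= (x - n%:~R * l) / sigma.
    by apply: divr_ge0; [rewrite subr_ge0|exact: ltW].
  have yY : (x - n%:~R * l) / sigma <= l2 / sigma.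
    by rewrite ler_pM2r ?invr_gt0 //; lra.
  by rewrite ler_norml; move: yY y0 l1_gt0 lin; rewrite /Y /period_increment; lra.
rewrite (@phase1E _ _ (n + 1)); last by move: nE l2x xn; rewrite /l; lra.
apply: ramp_close => //; rewrite ?nE ?nYE ?divr1.
- by move: l2x xn nE; rewrite /l; lra.
- by move: l1_gt0; lra.
- by rewrite /Y /period_increment; lra.
- by rewrite ler_norml; move: lin l2s l2x xn; rewrite nE /l /Y /period_increment; lra.
Qed.

(** An exponential keeps the orientation of the kinks, grows at a controlled
    rate and, for large [k], is as convex as desired. *)
Definition profile (k s rho x : R) : R := expR (k * phase s rho x).

Let patch_profile (k s rho yA A B p x : R) : A < x < B -> 0 < p ->
  `|s| = 1 -> `|rho| = 2^-1 ->
  (forall y, A <= y <= B -> phase s rho y = ramp s rho yA A B p y) ->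
  exists (h' : R -> R) (h'' : R),
    [/\ \forall y \near x, is_derive (y : R) 1 (profile k s rho) (h' y),
        is_derive x 1 h' h'',
        (k ^+ 2 / (4 * p ^+ 2) + k * (2 * rho / ((B - A) * p))) *
          profile k s rho x <= h'' &
        h'' <= (k ^+ 2 * (9 / (4 * p ^+ 2)) + k * (2 * rho / ((B - A) * p))) *
          profile k s rho x].
Proof.
move=> xAB p0 s1 rho2 hE; have AB : A < B by case/andP: xAB; exact: lt_trans.
have HE y : A <= y <= B -> profile k s rho y = expR (k * ramp s rho yA A B p y).
  by move=> yAB; rewrite /profile hE.
exists (fun y => expR (k * ramp s rho yA A B p y) * (k * ramp_slope s rho A B p y)).
exists ((k ^+ 2 * ramp_slope s rho A B p x ^+ 2 + k * (2 * rho / ((B - A) * p))) *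
      profile k s rho x).
have /andP[lo hi] := ramp_slope_bounds xAB p0 s1 rho2.
split.
- have : x \in `]A, B[ by rewrite in_itv.
  move/near_in_itvoo; apply: filterS => y; rewrite in_itv /= => yAB.
  exact: (glued_inside yAB HE (is_derive_exp_ramp k s rho yA y AB p0)).
- rewrite HE; last by case/andP: xAB => /ltW -> /ltW.
  exact: is_derive2_exp_ramp.
- by rewrite ler_pM2r ?expR_gt0 // lerD2r ler_wpM2l // sqr_ge0.
- by rewrite ler_pM2r ?expR_gt0 // lerD2r ler_wpM2l // sqr_ge0.
Qed.

Lemma profile_patch1 k s rho n x : `|s| = 1 -> `|rho| = 2^-1 ->
  patch1 l1 l2 n x -> exists (h' : R -> R) (h'' : R),
    [/\ \forall y \near x, is_derive (y : R) 1 (profile k s rho) (h' y),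
        is_derive x 1 h' h'',
        (k ^+ 2 / 4 + k * (2 * rho / l1)) * profile k s rho x <= h'' &
        h'' <= (k ^+ 2 * (9 / 4) + k * (2 * rho / l1)) * profile k s rho x].
Proof.
move=> s1 rho2; rewrite /patch1 /= in_itv /= -/l => xn.
have := patch_profile k xn ltr01 s1 rho2 (fun y => @phase1E s rho n y).
have -> : (n%:~R * l - (n%:~R * l - l1)) * 1 = l1 by ring.
by rewrite expr1n mulr1.
Qed.

Lemma profile_patch2 k s rho n x : `|s| = 1 -> `|rho| = 2^-1 ->
  patch2 l1 l2 n x -> exists (h' : R -> R) (h'' : R),
    [/\ \forall y \near x, is_derive (y : R) 1 (profile k s rho) (h' y),
        is_derive x 1 h' h'',
        (k ^+ 2 / (4 * sigma ^+ 2) + k * (2 * rho / (l2 * sigma))) *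
          profile k s rho x <= h'' &
        h'' <= (k ^+ 2 * (9 / (4 * sigma ^+ 2)) + k * (2 * rho / (l2 * sigma))) *
          profile k s rho x].
Proof.
move=> s1 rho2; rewrite /patch2 /= in_itv /= -/l => xn.
have := patch_profile k xn sigma_gt0 s1 rho2 (fun y => @phase2E s rho n y).
by have -> : n%:~R * l + l2 - n%:~R * l = l2 by ring.
Qed.

Let ramp_slope_endl (s rho A B p : R) : A < B ->
  ramp_slope s rho A B p A = (s - rho) / p.
Proof.
move=> AB; rewrite /ramp_slope subrr add0r -opprB mulNr divff ?mulrN1 //.
by rewrite gt_eqF // subr_gt0.
Qed.

Let ramp_slope_endr (s rho A B p : R) : A < B ->
  ramp_slope s rho A B p B = (s + rho) / p.
Proof.
by move=> AB; rewrite /ramp_slope subrr addr0 divff ?mulr1 // gt_eqF // subr_gt0.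
Qed.

Let interface_profile (k s rho yL yR A x B p q : R) : A < x < B ->
  0 < p -> 0 < q ->
  (forall y, A <= y <= x -> phase s rho y = ramp s rho yL A x p y) ->
  (forall y, x <= y <= B -> phase s rho y = ramp s rho yR x B q y) ->
  {for x, continuous (profile k s rho)} /\
  has_flux p q (profile k s rho) x (k * (s + rho) * profile k s rho x)
    (k * (s - rho) * profile k s rho x).
Proof.
move=> xAB p0 q0 hL hR; case/andP: (xAB) => Ax xB.
have HL y : A <= y <= x -> profile k s rho y = expR (k * ramp s rho yL A x p y).
  by move=> yA; rewrite /profile hL.
have HR y : x <= y <= B -> profile k s rho y = expR (k * ramp s rho yR x B q y).
  by move=> yB; rewrite /profile hR.
split.
  by apply: (glued_continuous xAB HL HR);
    apply: is_derive_continuous; exact: is_derive_exp_ramp.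
have := glued_flux p q xAB HL HR
  (fun y => is_derive_exp_ramp k s rho yL y Ax p0)
  (fun y => is_derive_exp_ramp k s rho yR y xB q0)
  (is_derive_continuous (is_derive2_exp_ramp k s rho yL x Ax p0))
  (is_derive_continuous (is_derive2_exp_ramp k s rho yR x xB q0)).
rewrite -HL ?lexx ?ltW // -HR ?lexx ?ltW // ramp_slope_endl // ramp_slope_endr //.
congr has_flux; field; exact: lt0r_neq0.
Qed.

Let S1_profile k s rho n :
  {for n%:~R * l, continuous (profile k s rho)} /\
  has_flux 1 sigma (profile k s rho) (n%:~R * l)
    (k * (s + rho) * profile k s rho (n%:~R * l))
    (k * (s - rho) * profile k s rho (n%:~R * l)).
Proof.
apply: (@interface_profile _ _ _ (n%:~R * Y - l1) (n%:~R * Y)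
  (n%:~R * l - l1) _ (n%:~R * l + l2)) => //.
- by rewrite gtrBl ltrDl l1_gt0.
- by move=> y; exact: phase1E.
- by move=> y; exact: phase2E.
Qed.

Let S2_profile k s rho n :
  {for n%:~R * l + l2, continuous (profile k s rho)} /\
  has_flux sigma 1 (profile k s rho) (n%:~R * l + l2)
    (k * (s + rho) * profile k s rho (n%:~R * l + l2))
    (k * (s - rho) * profile k s rho (n%:~R * l + l2)).
Proof.
have nE : (n + 1)%:~R * l - l1 = n%:~R * l + l2 by rewrite intrD /l; ring.
apply: (@interface_profile _ _ _ (n%:~R * Y) ((n + 1)%:~R * Y - l1)
  (n%:~R * l) _ ((n + 1)%:~R * l)) => //.
- by rewrite ltrDl l2_gt0 -nE gtrBl.
- by move=> y; exact: phase2E.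
- by move=> y; rewrite -nE; exact: phase1E.
Qed.

Lemma profile_S1 k s rho x : S1 l1 l2 x ->
  has_flux 1 sigma (profile k s rho) x
    (k * (s + rho) * profile k s rho x) (k * (s - rho) * profile k s rho x).
Proof. by move=> [n ->]; have [] := S1_profile k s rho n. Qed.

Lemma profile_S2 k s rho x : S2 l1 l2 x ->
  has_flux sigma 1 (profile k s rho) x
    (k * (s + rho) * profile k s rho x) (k * (s - rho) * profile k s rho x).
Proof. by move=> [n ->]; have [] := S2_profile k s rho n. Qed.

Lemma profile_continuous k s rho : `|s| = 1 -> `|rho| = 2^-1 ->
  continuous (profile k s rho).
Proof.
move=> s1 rho2 x.
case: (patch_cover l1_gt0 l2_gt0 x) => [[n xn]|[n xn]|[n ->]|[n ->]].
- have [h' [h'' [/nbhs_singleton dh _ _ _]]] := profile_patch1 k s1 rho2 xn.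
  exact: is_derive_continuous dh.
- have [h' [h'' [/nbhs_singleton dh _ _ _]]] := profile_patch2 k s1 rho2 xn.
  exact: is_derive_continuous dh.
- by have [] := S1_profile k s rho n.
- by have [] := S2_profile k s rho n.
Qed.

End Profile.

(** * Nonnegativity of solutions *)

Lemma strict_sub_affine (R : realType) (d : R) (f al be h h' : R -> R)
    (t x al' be' h'' : R) :
  is_derive t 1 al al' -> is_derive t 1 be be' ->
  (\forall y \near x, is_derive (y : R) 1 h (h' y)) -> is_derive x 1 h' h'' ->
  al' + be' * h x < d * (be t * h'') + f (al t + be t * h x) ->
  strict_sub d f (fun t x => al t + be t * h x) t x.
Proof.
move=> dal dbe dh dh' sub.
exists (al' + be' * h x), (fun y => be t * h' y), (be t * h''); split=> //.
- apply: (is_derive_eq (is_derive_addf dal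
    (is_derive_mulf dbe (is_derive_cstf t (h x))))).
  by rewrite mulr0 addr0.
- apply: filterS dh => y dhy; rewrite -[be t * h' y]add0r.
  exact (is_derive_addf (is_derive_cstf y (al t)) (is_derive_Mlf (be t) dhy)).
- exact (is_derive_Mlf (be t) dh').
Qed.

Lemma continuous_affine (R : realType) (al be h : R -> R) :
  continuous al -> continuous be -> continuous h ->
  continuous (fun z : R * R => al z.1 + be z.1 * h z.2).
Proof.
move=> alc bec hc z.
have c1 (g : R -> R) : continuous g -> g w.1 @[w --> z] --> g z.1.
  by move=> gc; apply: (@continuous_comp _ _ _ fst g); [exact: cvg_fst|exact: gc].
have c2 : h w.2 @[w --> z] --> h z.2.
  by apply: (@continuous_comp _ _ _ snd h); [exact: cvg_snd|exact: hc].
by apply: cvgD; [exact: c1|apply: cvgM; [exact: c1|exact: c2]].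
Qed.

Lemma normr_half (R : realType) : `|2^-1 : R| = 2^-1.
Proof. by rewrite ger0_norm // invr_ge0. Qed.

Section Nonnegativity.
Context (R : realType) (l1 l2 d1 d2 sigma : R) (f1 f2 u0 : R -> R).
Context (u : R -> R -> R) (l1_gt0 : 0 < l1) (l2_gt0 : 0 < l2).
Context (sigma_gt0 : 0 < sigma) (d1_gt0 : 0 < d1) (d2_gt0 : 0 < d2).
Context (f1_C1 : C1 f1) (f2_C1 : C1 f2) (f10 : f1 0 = 0) (f20 : f2 0 = 0).
Context (u0_ge0 : forall x, 0 <= u0 x).
Context (sol : patch_solution l1 l2 d1 d2 sigma f1 f2 u0 u).

Let h s := profile l1 l2 sigma 1 s 2^-1.
(** The analogue, for this medium, of the hyperbolic cosine. *)
Let cosh x := h 1 x + h (-1) x.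

Let cosh_gt0 x : 0 < cosh x.
Proof. by rewrite addr_gt0 // expR_gt0. Qed.

Let C := d1 * (9 / 4 + l1^-1) + d2 * (9 / (4 * sigma ^+ 2) + (l2 * sigma)^-1).

(** The kinks of [cosh] point downwards, hence those of its negative multiples
    point upwards. *)
Let cosh_S1 x : S1 l1 l2 x ->
  has_flux 1 sigma cosh x (2^-1 * cosh x + (h 1 x - h (-1) x))
    (- (2^-1) * cosh x + (h 1 x - h (-1) x)).
Proof.
move=> xS.
have := has_flux_add (profile_S1 l1_gt0 l2_gt0 sigma_gt0 1 1 2^-1 xS)
  (profile_S1 l1_gt0 l2_gt0 sigma_gt0 1 (-1) 2^-1 xS).
by congr has_flux; rewrite /cosh /h; ring.
Qed.

Let cosh_S2 x : S2 l1 l2 x ->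
  has_flux sigma 1 cosh x (2^-1 * cosh x + (h 1 x - h (-1) x))
    (- (2^-1) * cosh x + (h 1 x - h (-1) x)).
Proof.
move=> xS.
have := has_flux_add (profile_S2 l1_gt0 l2_gt0 sigma_gt0 1 1 2^-1 xS)
  (profile_S2 l1_gt0 l2_gt0 sigma_gt0 1 (-1) 2^-1 xS).
by congr has_flux; rewrite /cosh /h; ring.
Qed.

Let cosh_regular (d c c' x : R) (h1' h2' : R -> R) (h1'' h2'' : R) : 0 < d ->
  d * (c + c') <= C ->
  [/\ \forall y \near x, is_derive (y : R) 1 (h 1) (h1' y), is_derive x 1 h1' h1'' &
      h1'' <= (1 ^+ 2 * c + 1 * c') * h 1 x] ->
  [/\ \forall y \near x, is_derive (y : R) 1 (h (-1)) (h2' y), is_derive x 1 h2' h2'' &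
      h2'' <= (1 ^+ 2 * c + 1 * c') * h (-1) x] ->
  exists (g' : R -> R) (g'' : R),
    [/\ \forall y \near x, is_derive (y : R) 1 cosh (g' y), is_derive x 1 g' g'' &
        d * g'' <= C * cosh x].
Proof.
move=> d0 dC [dh1 dh1' h1le] [dh2 dh2' h2le].
exists (fun y => h1' y + h2' y), (h1'' + h2''); split.
- by apply: filterS2 dh1 dh2 => y; exact: is_derive_addf.
- exact (is_derive_addf dh1' dh2').
apply: (@le_trans _ _ (d * (c + c') * cosh x)); last by rewrite ler_pM2r.
by rewrite -mulrA ler_pM2l // mulrDr; move: h1le h2le; lra.
Qed.

Let sigma2_gt0 : 0 < 9 / (4 * sigma ^+ 2) + (l2 * sigma)^-1.
Proof. by rewrite addr_gt0 ?divr_gt0 ?invr_gt0 ?mulr_gt0 ?exprn_gt0. Qed.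

Let one_gt0 : 0 < 9 / 4 + l1^-1.
Proof. by rewrite addr_gt0 ?invr_gt0 ?divr_gt0. Qed.

Let cosh_patch1 n x : patch1 l1 l2 n x -> exists (g' : R -> R) (g'' : R),
    [/\ \forall y \near x, is_derive (y : R) 1 cosh (g' y), is_derive x 1 g' g'' &
        d1 * g'' <= C * cosh x].
Proof.
move=> xn; have half2 : 2 * 2^-1 / l1 = l1^-1 by rewrite divff // mul1r.
have [h1' [h1'' [dh1 dh1' _]]] :=
  profile_patch1 sigma l1_gt0 l2_gt0 1 (normr1 R) (normr_half R) xn.
have [h2' [h2'' [dh2 dh2' _]]] :=
  profile_patch1 sigma l1_gt0 l2_gt0 1 (normrN1 R) (normr_half R) xn.
rewrite half2 => h2le h1le.
apply: (@cosh_regular d1 (9 / 4) l1^-1 x h1' h2' h1'' h2'') => //.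
by rewrite /C lerDl mulr_ge0 // ltW.
Qed.

Let cosh_patch2 n x : patch2 l1 l2 n x -> exists (g' : R -> R) (g'' : R),
    [/\ \forall y \near x, is_derive (y : R) 1 cosh (g' y), is_derive x 1 g' g'' &
        d2 * g'' <= C * cosh x].
Proof.
move=> xn; have half2 : 2 * 2^-1 / (l2 * sigma) = (l2 * sigma)^-1.
  by rewrite divff // mul1r.
have [h1' [h1'' [dh1 dh1' _]]] :=
  profile_patch2 l1_gt0 l2_gt0 sigma_gt0 1 (normr1 R) (normr_half R) xn.
have [h2' [h2'' [dh2 dh2' _]]] :=
  profile_patch2 l1_gt0 l2_gt0 sigma_gt0 1 (normrN1 R) (normr_half R) xn.
rewrite half2 => h2le h1le.
apply: (@cosh_regular d2 (9 / (4 * sigma ^+ 2)) (l2 * sigma)^-1 x h1' h2' h1'' h2'') => //.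
by rewrite /C lerDr mulr_ge0 // ltW.
Qed.

Let C_ge0 : 0 <= C.
Proof. by rewrite addr_ge0 // mulr_ge0 // ltW. Qed.

Let lam := period_increment l1 l2 sigma / (l1 + l2).
Let D := 2 * period_increment l1 l2 sigma.

Let period_gt0 : 0 < period_increment l1 l2 sigma.
Proof. by rewrite addr_gt0 // divr_gt0. Qed.

Let cosh_coercive x : 1 + lam * `|x| - D <= cosh x.
Proof.
have one s : `|s| = 1 -> 1 + (s * (lam * x) - D) <= h s x.
  move=> s1; apply: le_trans (expR_ge1Dx _) _; rewrite ler_expR mul1r.
  have := phase_close l1_gt0 l2_gt0 sigma_gt0 x s1 (normr_half R).
  by rewrite ler_norml -/lam -/D; lra.
have [x0|x0] := ger0P x.
  by have := one 1 (normr1 R); have := expR_gt0 (1 * phase l1 l2 sigma (-1) 2^-1 x);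
    rewrite /cosh /h /profile; lra.
by have := one (-1) (normrN1 R); have := expR_gt0 (1 * phase l1 l2 sigma 1 2^-1 x);
    rewrite /cosh /h /profile; lra.
Qed.

Lemma cosh_continuous : continuous cosh.
Proof.
move=> x; apply: cvgD; apply: profile_continuous => //;
  by rewrite ?normr1 ?normrN1 ?normr_half.
Qed.

(** Where it touches [u], which is bounded, the function
    [- e * exp (A t) * cosh x] is a strict subsolution for large [A]; it is
    below [u] at infinity because [cosh] is coercive. If [u] were negative
    somewhere, a suitable choice of [e] would make both equal there. *)
Lemma solution_ge0 t x : 0 <= t -> 0 <= u t x.
Proof.
move=> t0; rewrite leNgt; apply/negP => utx.
have [|M0 uM0] := sol_bounded sol (T := t + 1); first lra.
pose M := `|M0| + 1; have M_gt0 : 0 < M by rewrite ltr_wpDl.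
have uM s y : 0 <= s <= t -> - M < u s y.
  move=> sT; have : `|u s y| <= M0 by apply: uM0; lra.
  by have := ler_norm M0; rewrite ler_norml /M; lra.
have [A1 A1_gt0 f1A] := C1_Lipschitz f1_C1 M_gt0.
have [A2 A2_gt0 f2A] := C1_Lipschitz f2_C1 M_gt0.
pose A := C + A1 + A2 + 1.
have A_gt0 : 0 < A by rewrite /A; move: C_ge0; lra.
have f1_ge s : - M < s < 0 -> A1 * s <= f1 s.
  by move=> sM; have := f1A s 0; rewrite f10 ler_norml; lra.
have f2_ge s : - M < s < 0 -> A2 * s <= f2 s.
  by move=> sM; have := f2A s 0; rewrite f20 ler_norml; lra.
pose e := - u t x / (expR (A * t) * cosh x).
have e_gt0 : 0 < e by rewrite divr_gt0 ?oppr_gt0 // mulr_gt0 ?expR_gt0.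
pose phi (s y : R) := 0 + (- e * expR (A * s)) * cosh y.
pose X := (M / e + D) / lam + `|x|.
have lam_gt0 : 0 < lam by rewrite divr_gt0 // addr_gt0.
have D_gt0 : 0 < D by rewrite mulr_gt0.
have X_gt0 : 0 < X.
  by rewrite ltr_wpDr // divr_gt0 // addr_gt0 // divr_gt0.
have xX : - X <= x <= X.
  by rewrite -ler_norml ler_wpDl // ltW // divr_gt0 // addr_gt0 // divr_gt0.
have exp_ge1 s : 0 <= s -> 1 <= expR (A * s).
  by move=> s0; rewrite -expR0 ler_expR mulr_ge0 // ltW.
have lateral s y : 0 <= s <= t -> `|y| = X -> phi s y < u s y.
  move=> sT yX; apply: le_lt_trans (uM s y sT); rewrite /phi add0r mulNr mulNr lerN2.
  have Mcosh : M / e <= cosh y.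
    have := cosh_coercive y; rewrite yX /X mulrDr mulrCA divff ?gt_eqF // mulr1.
    have : 0 <= lam * `|x| by rewrite mulr_ge0 // ltW.
    lra.
  rewrite -mulrA -ler_pdivrMl // [e^-1 * M]mulrC; apply: (le_trans Mcosh).
  by rewrite ler_peMl ?(ltW (cosh_gt0 y)) // exp_ge1 //; case/andP: sT.
have : phi t x < u t x.
  apply: (comparison l1_gt0 l2_gt0 sigma_gt0 sol (lexx 0) d1_gt0 d2_gt0
    (T1 := t) (a := - X) (b := X)) => //; rewrite ?t0 ?lexx //.
  - apply: (@continuous_affine R (fun=> 0) (fun s => - e * expR (A * s)) cosh);
      [by move=> s; exact: cvg_cst| |exact: cosh_continuous].
    move=> s; exact: (is_derive_continuous
      (is_derive_Mlf (- e) (is_derive_expf (is_derive_Mlf A (is_derive_idf s))))).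
  - move=> y _; rewrite (sol_init sol); apply: lt_le_trans (u0_ge0 y).
    by rewrite /phi add0r nmulr_rlt0 // mulNr oppr_lt0 mulr_gt0 ?expR_gt0.
  - move=> s sT; split; apply: lateral => //; rewrite ?normrN gtr0_norm //.
  - move=> s y sT yX uE.
    have E0 : 0 < expR (A * s) := expR_gt0 _.
    have phi_lt0 : phi s y < 0.
      rewrite /phi add0r mulNr mulNr oppr_lt0.
      by apply: mulr_gt0; [exact: mulr_gt0|exact: cosh_gt0].
    have phi_gtM : - M < phi s y by rewrite -uE; apply: uM; lra.
    have dbe : is_derive s 1 (fun r => - e * expR (A * r))
        (- e * (expR (A * s) * (A * 1))) :=
      is_derive_Mlf (- e) (is_derive_expf (is_derive_Mlf A (is_derive_idf s))).
    have main (d f' g'' : R) : d * g'' <= C * cosh y ->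
        (A1 + A2) * phi s y <= f' ->
        0 + - e * (expR (A * s) * (A * 1)) * cosh y <
        d * (- e * expR (A * s) * g'') + f'.
      have k0 : 0 < e * expR (A * s) by rewrite mulr_gt0.
      rewrite -(ler_pM2l k0) /phi /A => dg f'ge.
      have : 0 < e * expR (A * s) * cosh y by rewrite mulr_gt0.
      by move: f'ge dg; lra.
    have kink p q fl fr : has_flux p q cosh y fl fr -> fr < fl ->
        strict_kink p q (phi s) y.
      move=> /(has_flux_affine 0 (- e * expR (A * s))) flux frl.
      exists (- e * expR (A * s) * fl), (- e * expR (A * s) * fr); split=> //.
      by rewrite ltr_nM2l // mulNr oppr_lt0 mulr_gt0.
    split.
    + move=> n /cosh_patch1[g' [g'' [dg dg' gle]]].
      apply: (strict_sub_affine (is_derive_cstf s 0) dbe dg dg').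
      apply: main => //; apply: le_trans (f1_ge (phi s y) _); last by rewrite phi_gtM.
      by rewrite mulrDl gerDl nmulr_lle0 ?ltW // ltW.
    + move=> n /cosh_patch2[g' [g'' [dg dg' gle]]].
      apply: (strict_sub_affine (is_derive_cstf s 0) dbe dg dg').
      apply: main => //; apply: le_trans (f2_ge (phi s y) _); last by rewrite phi_gtM.
      by rewrite mulrDl gerDr pmulr_rle0 // ltW.
    + by move=> /cosh_S1 flux; apply: kink flux _; move: (cosh_gt0 y); lra.
    + by move=> /cosh_S2 flux; apply: kink flux _; move: (cosh_gt0 y); lra.
suff -> : phi t x = u t x by rewrite ltxx.
have k_neq0 : expR (A * t) * cosh x != 0 by rewrite gt_eqF // mulr_gt0 ?expR_gt0.
by rewrite /phi add0r -mulrA /e !mulNr opprK divfK.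
Qed.

End Nonnegativity.

(** * Invasion of the bistable patch *)

Section Invasion.
Context (R : realType) (f2 : R -> R) (theta K2 d2 : R).
Context (d2_gt0 : 0 < d2) (f2_C1 : C1 f2) (f2_bi : bistable f2 theta K2).

Let th0 : 0 < theta. Proof. by case: f2_bi => /andP[]. Qed.
Let thK : theta < K2. Proof. by case: f2_bi => /andP[]. Qed.
Let f2_cont : continuous f2.
Proof. by move=> x; exact: is_derive_continuous (C1_is_derive x f2_C1). Qed.

(** The subsolution is a very flat parabola [m0 + v t - rho t * (x - c) ^ 2]. Its
    top climbs from above [theta] to near [K2] at a speed [v] smaller than [f2]
    there, and [rho] grows at the Lipschitz rate of [f2], which compensates for
    the lower values of [f2] away from the top. The interval must be long enough
    for the parabola to be negative at its ends. *)
Lemma bistable_rise (eta m W : R) : 0 < eta -> 0 < m < K2 -> 0 < W ->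
  exists (L T : R), [/\ 0 < L, 0 < T, W < L / 2 &
  forall (l1 l2 d1 sigma : R) (f1 u0 : R -> R) (u : R -> R -> R) (n : int) (c : R),
    0 < l1 -> 0 < l2 -> 0 < sigma -> 0 < d1 ->
    patch_solution l1 l2 d1 d2 sigma f1 f2 u0 u ->
    (forall t x, 0 <= t -> 0 <= u t x) ->
    (forall x, c - L / 2 < x < c + L / 2 ->
       patch2 l1 l2 n x /\ theta + eta <= u0 x) ->
    forall x, `|x - c| <= W -> m < u T x].
Proof.
move=> eta0 mK W0.
have [_ _ _ _ fpos] := f2_bi.
have [m0 [m0th m0eta m0K]] :
    exists m0, [/\ theta < m0, m0 < theta + eta & m0 < K2].
  exists (theta + Order.min eta (K2 - theta) / 2).
  have e1 : Order.min eta (K2 - theta) <= eta by rewrite ge_min lexx.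
  have e2 : Order.min eta (K2 - theta) <= K2 - theta by rewrite ge_min lexx orbT.
  have e3 : 0 < Order.min eta (K2 - theta) by rewrite lt_min eta0 subr_gt0.
  by split; lra.
have [m1 [mm1 m01 m1K]] : exists m1, [/\ m < m1, m0 < m1 & m1 < K2].
  exists ((Order.max m m0 + K2) / 2).
  have e1 : m <= Order.max m m0 by rewrite le_max lexx.
  have e2 : m0 <= Order.max m m0 by rewrite le_max lexx orbT.
  have e3 : Order.max m m0 < K2 by rewrite gt_max; case/andP: mK => _ ->.
  by split; move: mK; lra.
have [v v0 f2v] : exists2 v : R, 0 < v & forall s, m0 <= s <= m1 -> 2 * v <= f2 s.
  have [||s0] := @EVT_min R f2 m0 m1; first lra.
    exact: continuous_subspaceT.
  rewrite in_itv /= => s0P smin; exists (f2 s0 / 2).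
    by rewrite divr_gt0 // fpos //; right; lra.
  by move=> s sm; have := smin s; rewrite in_itv /= => /(_ sm); lra.
have K20 : 0 < K2 by lra.
have [La La0 f2La] := C1_Lipschitz f2_C1 K20.
have [T T0 Tv] : exists2 T, 0 < T & v * T = m1 - m0.
  exists ((m1 - m0) / v); first by rewrite divr_gt0 // subr_gt0.
  by rewrite mulrC divfK // gt_eqF.
(* the final curvature: small enough for diffusion to be harmless and for the
   parabola to stay above m at the distance W of its axis *)
have [rho1 rho1_gt0 [rho1v rho1W]] : exists2 rho1, 0 < rho1 &
    rho1 * (4 * d2) <= v /\ rho1 * (2 * W ^+ 2) <= m1 - m.
  exists (Order.min (v / (4 * d2)) ((m1 - m) / (2 * W ^+ 2))).
    by rewrite lt_min !divr_gt0 ?mulr_gt0 ?exprn_gt0 // subr_gt0.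
  by rewrite -!ler_pdivlMr ?mulr_gt0 ?exprn_gt0 // !ge_min !lexx orbT.
have [rho [rho_gt0 drho rho_itv rhoT]] : exists rho : R -> R,
    [/\ forall t, 0 < rho t,
        forall t : R, is_derive t 1 (fun t => - rho t) (- (La * rho t)),
        forall t, 0 <= t <= T -> rho 0 <= rho t <= rho1 & rho T = rho1].
  exists (fun t => rho1 * expR (La * (t - T))); split.
  - by move=> t; rewrite mulr_gt0 ?expR_gt0.
  - move=> t; have dt : is_derive t 1 (fun t => La * (t - T)) _ :=
      is_derive_Mlf La (is_derive_subf (is_derive_idf t) (is_derive_cstf t T)).
    apply: (is_derive_eq (is_deriveN (is_derive_Mlf rho1 (is_derive_expf dt)))).
    by ring.
  - move=> t /andP[t0 tT]; rewrite ler_pM2l // ler_expR ler_pM2l // lerD2r t0.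
    apply: ler_piMr; first exact: ltW.
    by rewrite -[leRHS]expR0 ler_expR pmulr_rle0 // subr_le0.
  - by rewrite subrr mulr0 expR0 mulr1.
have [half [W_half half_far]] : exists half, W < half /\
    forall t, 0 <= t <= T -> K2 < rho t * half ^+ 2.
  have q0 : 0 < K2 / rho 0 by rewrite divr_gt0.
  exists (K2 / rho 0 + 1 + W); split; first lra.
  move=> t /rho_itv /andP[rho0t _].
  move: (K2 / rho 0) (divfK (lt0r_neq0 (rho_gt0 0)) K2) q0 => q qE q0.
  apply: (@lt_le_trans _ _ (rho 0 * (q + 1 + W) ^+ 2)); last first.
    by rewrite ler_pM2r // exprn_gt0 //; lra.
  rewrite -qE mulrC ltr_pM2l //.
  have : (q + 1) * 1 <= (q + 1 + W) * (q + 1 + W) by apply: ler_pM => //; lra.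
  by rewrite expr2; lra.
have half2 : 2 * half / 2 = half by rewrite mulrC mulKf.
exists (2 * half), T; rewrite half2; split=> //; first lra.
move=> l1 l2 d1 sigma f1 u0 u n c l1_gt0 l2_gt0 sigma_gt0 d1_gt0 sol u_ge0 u0P.
pose phi (t x : R) := m0 + v * t + - rho t * (x - c) ^+ 2.
have vt t : 0 <= t <= T -> m0 <= m0 + v * t <= m1.
  move=> /andP[t0 tT].
  have : 0 <= v * t by rewrite mulr_ge0 // ltW.
  have : v * t <= v * T by rewrite ler_pM2l.
  lra.
have dal (t : R) : is_derive t 1 (fun t => m0 + v * t) v.
  apply: (is_derive_eq (is_derive_addf (is_derive_cstf t m0)
    (is_derive_Mlf v (is_derive_idf t)))).
  by rewrite add0r mulr1.
have dh (x : R) : is_derive x 1 (fun x => (x - c) ^+ 2) (2 * (x - c)).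
  apply: (is_derive_eq (is_derive_sqrf
    (is_derive_subf (is_derive_idf x) (is_derive_cstf x c)))).
  by rewrite subr0 mulr1.
have dh' (x : R) : is_derive x 1 (fun x => 2 * (x - c)) 2.
  apply: (is_derive_eq (is_derive_Mlf 2
    (is_derive_subf (is_derive_idf x) (is_derive_cstf x c)))).
  by rewrite subr0 mulr1.
have lateral t x : 0 <= t <= T -> (x - c) ^+ 2 = half ^+ 2 -> phi t x < u t x.
  move=> tT xE; apply: lt_le_trans (u_ge0 t x _); last by case/andP: tT.
  by have := vt t tT; have := half_far t tT; rewrite /phi xE mulNr; lra.
have phi_le t x : phi t x <= m0 + v * t.
  by rewrite /phi gerDl mulNr oppr_le0 mulr_ge0 ?sqr_ge0 // ltW.
have below t x : 0 <= t <= T -> c - half <= x <= c + half -> phi t x < u t x.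
  apply: (comparison l1_gt0 l2_gt0 sigma_gt0 sol (lexx 0) d1_gt0 d2_gt0).
  - apply: (@continuous_affine R (fun t => m0 + v * t) (fun t => - rho t)
      (fun x => (x - c) ^+ 2)) => y; exact: is_derive_continuous.
  - move=> y yc; have [yh|yh] := eqVneq ((y - c) ^+ 2) (half ^+ 2).
      by apply: lateral => //; rewrite lexx ltW.
    rewrite (sol_init sol); apply: le_lt_trans (phi_le 0 y) _.
    rewrite mulr0 addr0; apply: lt_le_trans m0eta _.
    have [|//] := u0P y.
    have yc1 : y != c - half by apply: contraNneq yh => ->; apply/eqP; ring.
    have yc2 : y != c + half by apply: contraNneq yh => ->; apply/eqP; ring.
    by rewrite !lt_neqAle yc2 eq_sym yc1.
  - by move=> s sT; split; apply: lateral => //; ring.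
  - move=> s y sT yc uE.
    have [|yn _] := u0P y; first by [].
    split.
    + by move=> k /(patch12_disjoint l1_gt0 l2_gt0)/(_ yn).
    + move=> k _; apply: (strict_sub_affine (dal s) (drho s)
        (h' := fun x => 2 * (x - c)) _ (dh' y)).
        by near=> z; exact: dh.
      have phi_ge0 : 0 <= phi s y by rewrite -uE u_ge0 //; case/andP: sT => /ltW.
      have sT' : 0 <= s <= T by case/andP: sT => /ltW ->.
      have phiE : m0 + v * s - phi s y = rho s * (y - c) ^+ 2 by rewrite /phi; ring.
      rewrite -/(phi s y); move: (phi_le s y) (vt s sT') phi_ge0 phiE.
      move: (phi s y) => p ple mu p0 pE.
      have /andP[_] : - (La * (m0 + v * s - p)) <= f2 (m0 + v * s) - f2 p <=
          La * (m0 + v * s - p) by rewrite -ler_norml; apply: f2La; lra.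
      have : d2 * rho s <= d2 * rho1.
        by rewrite ler_pM2l //; case/andP: (rho_itv s sT').
      have := f2v _ mu; rewrite pE; move: rho1v v0; lra.
    + by move=> yS; case: (patch2_not_interface l1_gt0 l2_gt0 yn); left.
    + by move=> yS; case: (patch2_not_interface l1_gt0 l2_gt0 yn); right.
move=> x; rewrite ler_norml => xW.
have : phi T x < u T x.
  by apply: below; [rewrite lexx ltW|lra].
apply: le_lt_trans; rewrite /phi Tv rhoT.
have x2 : (x - c) ^+ 2 <= W ^+ 2.
  by rewrite -real_normK ?num_real // lerXn2r ?nnegrE // ?ler_norml // ltW.
have : rho1 * (x - c) ^+ 2 <= rho1 * W ^+ 2 by rewrite ler_pM2l.
by move: rho1W mm1; lra.
Unshelve. all: by end_near. Qed.

End Invasion.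

(** The bump is a stationary strict subsolution, negative at the ends of its
    interval: a nonnegative solution that is above it stays above it. *)
Lemma bump_persists (R : realType) (f2 : R -> R) (d2 m a b c : R)
    (psi psi' psi'' : R -> R) (l1 l2 d1 sigma T : R) (f1 u0 : R -> R)
    (u : R -> R -> R) (n : int) :
  psi a < 0 -> psi b < 0 -> continuous psi ->
  (forall x, a <= x <= b -> psi x <= m) ->
  (forall x, a < x < b -> [/\ is_derive x 1 psi (psi' x),
     is_derive x 1 psi' (psi'' x) & 0 < d2 * psi'' x + f2 (psi x)]) ->
  0 < l1 -> 0 < l2 -> 0 < sigma -> 0 < d1 -> 0 < d2 -> 0 <= T ->
  patch_solution l1 l2 d1 d2 sigma f1 f2 u0 u ->
  (forall t x, 0 <= t -> 0 <= u t x) ->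
  (forall x, c + a < x < c + b -> patch2 l1 l2 n x) ->
  (forall x, c + a <= x <= c + b -> m < u T x) ->
  forall t x, T <= t -> c + a <= x <= c + b -> psi (x - c) < u t x.
Proof.
move=> psia psib psic psim psiP l1_gt0 l2_gt0 sigma_gt0 d1_gt0 d2_gt0 T0 sol.
move=> u_ge0 inn uT t x Tt xab.
have shift (y : R) : is_derive y 1 (fun y : R => y - c) 1.
  by apply: (is_derive_eq (is_derive_subf (is_derive_idf y) (is_derive_cstf y c)));
    rewrite subr0.
apply: (comparison l1_gt0 l2_gt0 sigma_gt0 sol (phi := fun _ x => psi (x - c))
  (T0 := T) (T1 := t) (a := c + a) (b := c + b)) => //; rewrite ?Tt ?lexx //.
- move=> z; apply: (@continuous_comp _ _ _ (fun z : R * R => z.2 - c) psi).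
    by apply: cvgB; [exact: cvg_snd|exact: cvg_cst].
  exact: psic.
- by move=> y yab; apply: le_lt_trans (uT y yab); apply: psim; lra.
- move=> s sT; split; [rewrite addrAC|rewrite [c + b]addrC addrK].
    by rewrite subrr add0r (lt_le_trans psia) // u_ge0; lra.
  by rewrite (lt_le_trans psib) // u_ge0; lra.
move=> s y sT yab _; have yn := inn y yab.
split.
- by move=> k /(patch12_disjoint l1_gt0 l2_gt0)/(_ yn).
- move=> k _; have [|dpsi dpsi' sub] := psiP (y - c); first lra.
  exists 0, (fun y => psi' (y - c)), (psi'' (y - c)); split.
  + exact: is_derive_cstf.
  + have : y \in `](c + a), (c + b)[ by rewrite in_itv.
    move/near_in_itvoo; apply: filterS => z; rewrite in_itv /= => zab.
    have [|dz _ _] := psiP (z - c); first lra.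
    apply: (is_derive_eq
      (@is_derive1_comp _ psi (fun y => y - c) z _ _ dz (shift z))).
    by rewrite mulr1.
  + apply: (is_derive_eq
      (@is_derive1_comp _ psi' (fun y => y - c) y _ _ dpsi' (shift y))).
    by rewrite mulr1.
  + exact: sub.
- by move=> yS; case: (patch2_not_interface l1_gt0 l2_gt0 yn); left.
- by move=> yS; case: (patch2_not_interface l1_gt0 l2_gt0 yn); right.
Qed.

(** * Spreading of positivity *)

Lemma strict_kink_affine (R : realType) (p q : R) (v : R -> R) (x al be : R) :
  0 < be -> strict_kink p q v x -> strict_kink p q (fun y => al + be * v y) x.
Proof.
move=> be0 [fl [fr [flux flr]]]; exists (be * fl), (be * fr).
by split; [exact: has_flux_affine|rewrite ltr_pM2l].
Qed.

Lemma exponential_decay (R : realType) (T H : R) : 0 < H ->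
  exists g : R -> R, [/\ forall t, 0 < g t,
    forall t : R, is_derive t 1 g (- (2^-1 * g t)), g T = H &
    forall e, 0 < e -> exists2 T', T <= T' & forall t, T' <= t -> g t <= e].
Proof.
move=> H0; exists (fun t => H * expR (- (2^-1) * (t - T))); split.
- by move=> t; rewrite mulr_gt0 ?expR_gt0.
- move=> t; have dt : is_derive t 1 (fun t => - (2^-1) * (t - T)) _ :=
    is_derive_Mlf (- (2^-1)) (is_derive_subf (is_derive_idf t) (is_derive_cstf t T)).
  by apply: (is_derive_eq (is_derive_Mlf H (is_derive_expf dt))); ring.
- by rewrite subrr mulr0 expR0 mulr1.
move=> e e0; have He0 : 0 < H / e by rewrite divr_gt0.
exists (T + 2 * (H / e)); first by rewrite lerDl mulr_ge0 // ltW.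
move=> t Tt; rewrite mulNr expRN ler_pdivrMr ?expR_gt0 // -ler_pdivrMl //.
rewrite mulrC; apply: le_trans (expR_ge1Dx _); apply: ler_wpDl => //.
by move: Tt; lra.
Qed.

(** Where the subsolution [A * (h - far - g)], with [g' = - g / 2], is nonnegative,
    [g < h]: its time derivative [A * g / 2] is then absorbed by the extra unit in
    [M + 1], the rest balancing the reaction term. *)
Lemma shifted_profile_strict (R : realType) (A M far g h d h'' f' : R) :
  0 < A -> 0 < M -> 0 < far -> 0 < g -> 0 <= - A * (far + g) + A * h ->
  (M + 1) * h <= d * h'' -> - M * (- A * (far + g) + A * h) <= f' ->
  A * (2^-1 * g) + 0 * h < d * (A * h'') + f'.
Proof.
move=> A0 M0 far0 g0; have -> : - A * (far + g) + A * h = A * (h - far - g) by ring.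
rewrite pmulr_rge0 // => h_ge dh f'_ge.
have := ler_wpM2l (ltW A0) dh.
have : A * g < A * h by rewrite ltr_pM2l //; lra.
have : 0 < A * g by rewrite mulr_gt0.
have : 0 <= M * (A * (far + g)) by rewrite !mulr_ge0 //; lra.
lra.
Qed.

Section Spreading.
Context (R : realType) (l1 l2 d1 d2 sigma : R) (f1 f2 u0 : R -> R).
Context (u : R -> R -> R) (l1_gt0 : 0 < l1) (l2_gt0 : 0 < l2).
Context (sigma_gt0 : 0 < sigma) (d1_gt0 : 0 < d1) (d2_gt0 : 0 < d2).
Context (f1_C1 : C1 f1) (f2_C1 : C1 f2) (f10 : f1 0 = 0) (f20 : f2 0 = 0).
Context (sol : patch_solution l1 l2 d1 d2 sigma f1 f2 u0 u).
Context (u_ge0 : forall t x, 0 <= t -> 0 <= u t x).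

(** For a steep profile, diffusion dominates any linear absorption rate. *)
Let steep_profile (N : R) : exists2 k : R, 0 < k & forall s : R, `|s| = 1 ->
  (forall n x, patch1 l1 l2 n x -> exists (h' : R -> R) (h'' : R),
    [/\ \forall y \near x,
          is_derive (y : R) 1 (profile l1 l2 sigma k s (- 2^-1)) (h' y),
        is_derive x 1 h' h'' &
        N * profile l1 l2 sigma k s (- 2^-1) x <= d1 * h'']) /\
  (forall n x, patch2 l1 l2 n x -> exists (h' : R -> R) (h'' : R),
    [/\ \forall y \near x,
          is_derive (y : R) 1 (profile l1 l2 sigma k s (- 2^-1)) (h' y),
        is_derive x 1 h' h'' &
        N * profile l1 l2 sigma k s (- 2^-1) x <= d2 * h'']).
Proof.
have r2 : `|- 2^-1 : R| = 2^-1 by rewrite normrN normr_half.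
pose be2 := (l2 * sigma)^-1; pose al2 := (4 * sigma ^+ 2)^-1.
have al2_gt0 : 0 < al2 by rewrite invr_gt0 mulr_gt0 // exprn_gt0.
have be2_gt0 : 0 < be2 by rewrite invr_gt0 mulr_gt0.
have be1_gt0 : 0 < l1^-1 by rewrite invr_gt0.
pose k1 := (l1^-1 + `|N| / d1) * 4; pose k2 := (be2 + `|N| / d2) / al2.
have k1_gt0 : 0 < k1 by rewrite mulr_gt0 // ltr_wpDr // divr_ge0 // ltW.
have k2_gt0 : 0 < k2 by rewrite divr_gt0 // ltr_wpDr // divr_ge0 // ltW.
pose k := 1 + k1 + k2; have [k_ge1 k1k k2k] : [/\ 1 <= k, k1 <= k & k2 <= k].
  by rewrite /k; split; lra.
have k_gt0 : 0 < k by lra.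
have enough (d al be : R) : 0 < d -> 0 < al -> be + `|N| / d <= k * al ->
    N <= d * (k ^+ 2 * al + k * (- be)).
  move=> d0 al0 kal; have Nd0 : 0 <= `|N| / d by rewrite divr_ge0 // ltW.
  apply: (le_trans (ler_norm N)).
  have -> : k ^+ 2 * al + k * (- be) = k * (k * al - be) by ring.
  rewrite -ler_pdivrMl // mulrC; apply: (@le_trans _ _ (k * al - be)).
    lra.
  by apply: ler_peMl => //; lra.
exists k => // s s1; split=> n x xn.
- have [h' [h'' [dh dh' + _]]] := profile_patch1 sigma l1_gt0 l2_gt0 k s1 r2 xn.
  have -> : 2 * (- 2^-1) / l1 = - l1^-1 by rewrite mulrN divff // mulN1r.
  move=> hge; exists h', h''; split=> //.
  apply: (@le_trans _ _ (d1 * ((k ^+ 2 / 4 + k * - l1^-1) *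
    profile l1 l2 sigma k s (- 2^-1) x))).
    rewrite mulrA ler_pM2r ?expR_gt0 //; apply: enough => //.
    by rewrite ler_pdivlMr.
  by rewrite ler_pM2l.
- have [h' [h'' [dh dh' + _]]] := profile_patch2 l1_gt0 l2_gt0 sigma_gt0 k s1 r2 xn.
  have -> : 2 * (- 2^-1) / (l2 * sigma) = - be2 by rewrite mulrN divff // mulN1r.
  move=> hge; exists h', h''; split=> //.
  apply: (@le_trans _ _ (d2 * ((k ^+ 2 * al2 + k * - be2) *
    profile l1 l2 sigma k s (- 2^-1) x))).
    rewrite mulrA ler_pM2r ?expR_gt0 //; apply: enough => //.
    by rewrite -ler_pdivrMr.
  by rewrite ler_pM2l.
Qed.

Let lam := period_increment l1 l2 sigma / (l1 + l2).
Let D := 2 * period_increment l1 l2 sigma.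

Let period_gt0 : 0 < period_increment l1 l2 sigma.
Proof. by rewrite addr_gt0 // divr_gt0. Qed.

(** A profile decreasing in the direction [s], up to bounded oscillations of
    its phase: its values beyond some distance [N1] from [x0] are smaller than
    those up to the distance [N]. *)
Let decaying_profile (rate s x0 N : R) : `|s| = 1 ->
  exists (h : R -> R) (N1 top low far : R),
  [/\ continuous h /\ forall x, 0 < h x,
      (forall n x, patch1 l1 l2 n x -> exists (h' : R -> R) (h'' : R),
        [/\ \forall y \near x, is_derive (y : R) 1 h (h' y),
            is_derive x 1 h' h'' & rate * h x <= d1 * h'']) /\
      (forall n x, patch2 l1 l2 n x -> exists (h' : R -> R) (h'' : R),
        [/\ \forall y \near x, is_derive (y : R) 1 h (h' y),
            is_derive x 1 h' h'' & rate * h x <= d2 * h'']),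
      (forall x, S1 l1 l2 x -> strict_kink 1 sigma h x) /\
      (forall x, S2 l1 l2 x -> strict_kink sigma 1 h x),
      N < N1 /\ 0 < far < low &
      [/\ forall r, 0 <= r -> h (x0 + s * r) <= top,
          forall r, r <= N -> low <= h (x0 + s * r) &
          h (x0 + s * N1) <= far]].
Proof.
move=> s1.
have lam_gt0 : 0 < lam by rewrite divr_gt0 // addr_gt0.
have D_gt0 : 0 < D by rewrite mulr_gt0.
have r2 : `|- 2^-1 : R| = 2^-1 by rewrite normrN normr_half.
have s1' : `|- s| = 1 by rewrite normrN.
have ss : s * s = 1.
  have [->|->] : s = 1 \/ s = -1; last by ring.
    by case: (ger0P s) s1 => _ sE; [left|right]; lra.
  by ring.
have [k k0 /(_ _ s1')[h1P h2P]] := steep_profile rate.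
have kink_gt x : k * (- s + - 2^-1) * profile l1 l2 sigma k (- s) (- 2^-1) x <
    k * (- s - - 2^-1) * profile l1 l2 sigma k (- s) (- 2^-1) x.
  rewrite ltr_pM2r ?expR_gt0 // ltr_pM2l // ltrD2l.
  by rewrite opprK (lt_trans _ (_ : 0 < 2^-1)) ?oppr_lt0 ?invr_gt0.
have lamE : lam * ((2 * D + 1) / lam) = 2 * D + 1 by rewrite mulrC divfK // gt_eqF.
pose E0 := - s * (lam * x0).
have hP r : expR (k * (E0 - lam * r - D)) <=
    profile l1 l2 sigma k (- s) (- 2^-1) (x0 + s * r) <=
    expR (k * (E0 - lam * r + D)).
  have := phase_close l1_gt0 l2_gt0 sigma_gt0 (x0 + s * r) s1' r2.
  have -> : - s * (period_increment l1 l2 sigma / (l1 + l2) * (x0 + s * r)) =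
      E0 - lam * r.
    by rewrite -/lam /E0 -[in RHS](mulr1 (lam * r)) -ss; ring.
  rewrite ler_norml -/D /profile !ler_expR !ler_pM2l // => /andP[lo hi].
  rewrite lerBrDr [- D + _]addrC in lo; rewrite lerBlDr [D + _]addrC in hi.
  by rewrite lo.
exists (profile l1 l2 sigma k (- s) (- 2^-1)), (N + (2 * D + 1) / lam),
  (expR (k * (E0 + D))), (expR (k * (E0 - lam * N - D))),
  (expR (k * (E0 - lam * N - D - 1))); split.
- by split=> [|x]; [exact: profile_continuous|exact: expR_gt0].
- by [].
- split=> x xS; do 2 eexists; split; try exact: kink_gt.
    exact: profile_S1.
  exact: profile_S2.
- rewrite ltrDl divr_gt0 //; last by rewrite ltr_pwDr // mulr_ge0 // ltW.
  by rewrite expR_gt0 ltr_expR ltr_pM2l // gtrBl ltr01.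
split=> [r r0|r rN|].
- case/andP: (hP r) => _ /le_trans; apply; rewrite ler_expR ler_pM2l //.
  by rewrite lerD2r gerBl mulr_ge0 // ltW.
- case/andP: (hP r) => + _; apply: le_trans; rewrite ler_expR ler_pM2l //.
  by rewrite !lerD2r lerD2l lerN2 ler_pM2l.
case/andP: (hP (N + (2 * D + 1) / lam)) => _ /le_trans; apply.
rewrite ler_expR ler_pM2l // mulrDr lamE.
by have -> : E0 - (lam * N + (2 * D + 1)) + D = E0 - lam * N - D - 1 by ring.
Qed.

(** Positivity at [x0] propagates in the direction [s]: the subsolution is a
    multiple of a convex profile decreasing in the direction [s], shifted down
    so as to be negative initially and, at all times, at a distant point. *)
Lemma positivity_spreads (s x0 c T N : R) :
  `|s| = 1 -> 0 < c -> 0 <= T -> 0 < N ->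
  (forall t, T <= t -> c <= u t x0) ->
  exists (c' T' : R), 0 < c' /\
    forall t r, T' <= t -> 0 <= r <= N -> c' <= u t (x0 + s * r).
Proof.
move=> s1 c0 T0 N0 ux0.
have s_pm : s = 1 \/ s = -1.
  by case: (ger0P s) s1 => _ sE; [left|right]; lra.
have ss : s * s = 1 by case: s_pm => ->; ring.
have [M1 M1_gt0 f1M] := C1_Lipschitz f1_C1 (@ltr01 R).
have [M2 M2_gt0 f2M] := C1_Lipschitz f2_C1 (@ltr01 R).
have [M M_gt0 [f1_ge f2_ge]] : exists2 M, 0 < M &
    (forall p, 0 <= p <= 1 -> - M * p <= f1 p) /\
    (forall p, 0 <= p <= 1 -> - M * p <= f2 p).
  exists (M1 + M2); first exact: addr_gt0.
  split=> p /andP[p0 p1].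
    have : - (M1 * (p - 0)) <= f1 p - f1 0 <= M1 * (p - 0).
      by rewrite -ler_norml; apply: f1M => //; rewrite oppr_le0 ler01.
    by rewrite f10 !subr0 => /andP[+ _]; have := mulr_ge0 (ltW M2_gt0) p0; lra.
  have : - (M2 * (p - 0)) <= f2 p - f2 0 <= M2 * (p - 0).
    by rewrite -ler_norml; apply: f2M => //; rewrite oppr_le0 ler01.
  by rewrite f20 !subr0 => /andP[+ _]; have := mulr_ge0 (ltW M1_gt0) p0; lra.
have [h [N1 [HM [Hm [Hs [[hc h_gt0] [h1P h2P] [kink1 kink2] [NN1 Hsm]]]]]]] :=
  decaying_profile (M + 1) x0 N s1.
case/andP: Hsm => Hs0 Hsm [h_le h_ge h_far].
have HM0 : 0 < HM := lt_le_trans (h_gt0 _) (h_le 0 (lexx 0)).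
have [A A_gt0 [AHMc AHM1]] : exists2 A, 0 < A & A * HM < c /\ A * HM <= 1.
  have min_gt0 : 0 < Order.min c 1 by rewrite lt_min c0 ltr01.
  exists (Order.min c 1 / 2 / HM); first by rewrite !divr_gt0.
  rewrite divfK ?gt_eqF // ltr_pdivrMr // ler_pdivrMr //; split.
    by have : Order.min c 1 <= c by [rewrite ge_min lexx]; lra.
  by have : Order.min c 1 <= 1 by [rewrite ge_min lexx orbT]; lra.
have [g [g_gt0 dg gT g_small]] := exponential_decay T HM0.
pose phi (t x : R) := - A * (Hs + g t) + A * h x.
have phiE t x : phi t x = - A * (Hs + g t) + A * h x by [].
have dal (t : R) : is_derive t 1 (fun t => - A * (Hs + g t)) (A * (2^-1 * g t)).
  apply: (is_derive_eq (is_derive_Mlf (- A)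
    (is_derive_addf (is_derive_cstf t Hs) (dg t)))).
  by rewrite add0r mulrN mulNr opprK.
have phic : continuous (fun z : R * R => phi z.1 z.2).
  apply: (@continuous_affine R (fun t => - A * (Hs + g t)) (fun=> A) h) => //.
  - by move=> y; exact: is_derive_continuous (dal y).
  - by move=> y; exact: cvg_cst.
have sub t x : T < t -> h x <= HM -> u t x = phi t x ->
  [/\ forall n, patch1 l1 l2 n x -> strict_sub d1 f1 phi t x,
      forall n, patch2 l1 l2 n x -> strict_sub d2 f2 phi t x,
      S1 l1 l2 x -> strict_kink 1 sigma (phi t) x &
      S2 l1 l2 x -> strict_kink sigma 1 (phi t) x].
  move=> Tt hxM uE.
  have phi0 : 0 <= phi t x by rewrite -uE u_ge0 // (le_trans T0) // ltW.
  have phi_le : phi t x <= A * h x.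
    by rewrite /phi gerDr mulNr oppr_le0 mulr_ge0 // ltW // addr_gt0.
  have phi1 : phi t x <= 1.
    by apply: le_trans phi_le (le_trans _ AHM1); rewrite ler_pM2l.
  have dbe : is_derive t 1 (fun _ : R => A) 0 := is_derive_cstf t A.
  have main (d f' h'' : R) := @shifted_profile_strict _ _ _ _ _ _ d h'' f'
    A_gt0 M_gt0 Hs0 (g_gt0 t) phi0.
  split.
  - move=> n /h1P[h' [h'' [dh dh' hge]]].
    apply: (strict_sub_affine (dal t) dbe dh dh'); apply: main => //.
    by apply: f1_ge; rewrite phi0.
  - move=> n /h2P[h' [h'' [dh dh' hge]]].
    apply: (strict_sub_affine (dal t) dbe dh dh'); apply: main => //.
    by apply: f2_ge; rewrite phi0.
  - by move=> /kink1; exact: strict_kink_affine.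
  - by move=> /kink2; exact: strict_kink_affine.
have at_x0 t : T <= t -> phi t x0 < u t x0.
  move=> Tt; apply: (lt_le_trans _ (ux0 t Tt)); apply: le_lt_trans AHMc.
  have hx0 : h x0 <= HM by have := h_le 0 (lexx 0); rewrite mulr0 addr0.
  apply: (@le_trans _ _ (A * h x0)); last by rewrite ler_pM2l.
  by rewrite /phi gerDr mulNr oppr_le0 mulr_ge0 // ltW // addr_gt0.
have neg t x : T <= t -> h x < Hs + g t -> phi t x < u t x.
  move=> Tt hx; apply: lt_le_trans (u_ge0 x (le_trans T0 Tt)).
  by rewrite phiE mulNr addrC -mulrBr pmulr_rlt0 // subr_lt0.
have at_far t : T <= t -> phi t (x0 + s * N1) < u t (x0 + s * N1).
  by move=> Tt; apply: neg => //; apply: le_lt_trans h_far _; rewrite ltrDl.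
have initially r : 0 <= r -> phi T (x0 + s * r) < u T (x0 + s * r).
  move=> r0; apply: neg => //; rewrite gT; apply: le_lt_trans (h_le r r0) _.
  by rewrite ltrDr.
have coord x : x = x0 + s * (s * (x - x0)) by rewrite mulrA ss; ring.
have below t r : T <= t -> 0 <= r <= N1 -> phi t (x0 + s * r) < u t (x0 + s * r).
  move=> Tt rN1.
  have cmp a b := comparison l1_gt0 l2_gt0 sigma_gt0 sol (T1 := t) (a := a)
    (b := b) T0 d1_gt0 d2_gt0 phic.
  have sub' q x : T < q -> 0 <= s * (x - x0) -> u q x = phi q x -> _ :=
    fun Tq r0 => sub q x Tq (eq_rect_r (fun x => h x <= HM) (h_le _ r0) (coord x)).
  case: s_pm => sE; rewrite sE in coord sub' initially at_far rN1 *.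
  - apply: (cmp x0 (x0 + N1)); rewrite ?Tt ?lexx //; last lra.
    + by move=> x xN1; rewrite (coord x); apply: initially; lra.
    + move=> q /andP[Tq _]; split; first exact: at_x0.
      by rewrite -[N1]mul1r; exact: at_far.
    + by move=> q x /andP[Tq _] xN1; apply: sub' => //; lra.
  - apply: (cmp (x0 - N1) x0); rewrite ?Tt ?lexx //; last lra.
    + by move=> x xN1; rewrite (coord x); apply: initially; lra.
    + move=> q /andP[Tq _]; split; last exact: at_x0.
      by rewrite -mulN1r; exact: at_far.
    + by move=> q x /andP[Tq _] xN1; apply: sub' => //; lra.
pose gap := (Hm - Hs) / 2; have gap0 : 0 < gap by rewrite divr_gt0 // subr_gt0.
have [T' TT' gT'] := g_small _ gap0.
exists (A * gap), T'; split; first exact: mulr_gt0.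
move=> t r T't /andP[r0 rN].
apply: (@le_trans _ _ (phi t (x0 + s * r))); last first.
  apply/ltW/below; first exact: le_trans T't.
  by rewrite r0 (le_trans rN) // ltW.
have -> : phi t (x0 + s * r) = A * (h (x0 + s * r) - Hs - g t).
  by rewrite /phi; ring.
rewrite ler_pM2l //; move: (gT' t T't) (h_ge r rN); rewrite /gap.
lra.
Qed.

End Spreading.

(** * Local persistence *)

Lemma limf_einf_ge (R : realType) (f : R -> R) (c T : R) :
  (forall t, T <= t -> c <= f t) ->
  (c%:E <= limf_einf (fun t => (f t)%:E) +oo%R)%E.
Proof.
move=> fc; rewrite limf_einfE.
apply: le_trans (ereal_sup_ubound _); last first.
  by exists [set t | T <= t] => //=; exact: nbhs_pinfty_ge (num_real T).
by apply: le_ereal_inf_tmp => _ [t /= Tt <-]; rewrite lee_fin fc.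
Qed.

Theorem theorem2p2 (R : realType) (l1 d1 d2 sigma : R) (f1 f2 : R -> R)
    (K1 K2 theta : R)
    (l1_gt0 : 0 < l1) (d1_gt0 : 0 < d1) (d2_gt0 : 0 < d2) (sigma_gt0 : 0 < sigma)
    (f1_C1 : C1 f1) (f2_C1 : C1 f2)
    (f1_kpp : kpp f1 K1) (f2_bistable : bistable f2 theta K2)
    (f2_mass : 0 < \int[lebesgue_measure]_(s in `[0, K2]) f2 s) :
  forall eta : R, 0 < eta ->
  exists2 L : R, 0 < L &
  forall l2 : R, L <= l2 ->
  forall (u0 : R -> R) (u : R -> R -> R),
    continuous u0 ->
    (forall x, 0 <= u0 x) ->
    compact (closure [set x | u0 x != 0]) ->
    (exists x, u0 x != 0) ->
    (exists (n : int) (a : R), `]a, a + L[ `<=` patch2 l1 l2 n /\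
       forall x, x \in `]a, a + L[ -> theta + eta <= u0 x) ->
    patch_solution l1 l2 d1 d2 sigma f1 f2 u0 u ->
    locally_persistent u.
Proof.
have [_ [f10 _] _ _ _] := f1_kpp.
have [_ [f20 _ _] _ _ _] := f2_bistable.
have [m [a [b [psi [psi' [psi'' [mK ab [psia psib] psi0 [psic psim psiP]]]]]]]] :=
  subsolution_bump d2_gt0 f2_C1 f2_bistable f2_mass.
move=> eta eta_gt0.
have [|L [T [L_gt0 T_gt0 WL rise]]] :=
  bistable_rise d2_gt0 f2_C1 f2_bistable eta_gt0 mK (W := b - a); first lra.
exists L => // l2 Ll2 u0 u _ u0_ge0 _ _ [n [a0 [a0n u0a0]]] sol.
have l2_gt0 : 0 < l2 := lt_le_trans L_gt0 Ll2.
have u_ge0 := solution_ge0 l1_gt0 l2_gt0 sigma_gt0 d1_gt0 d2_gt0 f1_C1 f2_C1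
  f10 f20 u0_ge0 sol.
pose c := a0 + L / 2.
have in_patch x : c - L / 2 < x < c + L / 2 ->
    patch2 l1 l2 n x /\ theta + eta <= u0 x.
  move=> xc; have xa0 : x \in `]a0, a0 + L[.
    by rewrite in_itv /=; move: xc; rewrite /c; lra.
  by split; [exact: a0n|exact: u0a0].
have uT x : c + a <= x <= c + b -> m < u T x.
  move=> xc; apply: (rise l1 l2 d1 sigma f1 u0 u n c) => //.
  by rewrite ler_norml; lra.
have uc t : T <= t -> psi 0 <= u t c.
  move=> Tt; rewrite -(subrr c); apply: ltW.
  apply: (bump_persists psia psib psic psim psiP l1_gt0 l2_gt0 sigma_gt0 d1_gt0
    d2_gt0 (ltW T_gt0) sol u_ge0 (n := n) _ uT) => //; last lra.
  by move=> x xc; have [|//] := in_patch x; lra.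
move=> H _ /pinfty_ex_gt0[M M_gt0 HM].
have N_gt0 : 0 < M + `|c| by rewrite ltr_wpDr.
have spread s s1 := positivity_spreads l1_gt0 l2_gt0 sigma_gt0 d1_gt0 d2_gt0
  f1_C1 f2_C1 f10 f20 sol u_ge0 (s := s) s1 psi0 (ltW T_gt0) N_gt0 uc.
have [c1 [T1 [c1_gt0 uc1]]] := spread _ (normr1 R).
have [c2 [T2 [c2_gt0 uc2]]] := spread _ (normrN1 R).
apply: (@lt_le_trans _ _ (Order.min c1 c2)%:E).
  by rewrite lte_fin lt_min c1_gt0.
apply: le_ereal_inf_tmp => _ [x Hx <-].
apply: (@limf_einf_ge _ _ _ (Order.max T1 T2)) => t.
rewrite ge_max => /andP[T1t T2t].
have xN : `|x - c| <= M + `|c|.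
  by apply: le_trans (ler_normB _ _) _; rewrite lerD2r; exact: HM.
have [xc|xc] := ger0P (x - c); rewrite ge_min; apply/orP; [left|right].
  have -> : x = c + 1 * (x - c) by ring.
  by apply: uc1 => //; rewrite xc -(ger0_norm xc).
have -> : x = c + -1 * (c - x) by ring.
by apply: uc2 => //; move: xN; rewrite ltr0_norm //; lra.
Qed.
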